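(* Consider Problem P2. For a fixed policy $\Gamma^1$ of O1, an optimal policy of O2 (one minimizing $\mathbb{E}^{\Gamma^1,\Gamma^2}\{c^1\tau^1+c^2\tau^2+J(U^2_{\tau^2},H)\}$ over $\Gamma^2$) is of the form $$U^2_{T^2}=\begin{cases}1 & \text{if } \pi^2_{T^2}\le\alpha_{T^2}\\ 0&\text{if } \pi^2_{T^2}>\alpha_{T^2}\end{cases}$$ and, for $k=1,\dots,T^2-1$, $$U^2_k=\begin{cases}1&\text{if } \pi^2_k\le\alpha_k(Z^1_{1:k})\\ N&\text{if } \alpha_k(Z^1_{1:k})<\pi^2_k<\beta_k(Z^1_{1:k})\\ 0&\text{if } \pi^2_k\ge\beta_k(Z^1_{1:k})\end{cases}$$ where $0\le\alpha_k(Z^1_{1:k})\le\beta_k(Z^1_{1:k})\le1$ are thresholds that depend on the sequence of messages $Z^1_{1:k}$ received from O1.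
   Context: **Model.** $H\in\{0,1\}$ is random with known prior $P(H=0)=p_0$, $P(H=1)=1-p_0$. There are two observers O1, O2. $Y^i_t\in\mathcal{Y}^i$ is the observation of O$i$ at time $t$; given $H$, it has either a discrete distribution $P^i_t(\cdot|H)$ or a density $f^i_t(\cdot|H)$. Given $H$, the observations of each observer at different times are independent, and the two observation sequences are independent. $X_{1:t}$ denotes $X_1,\dots,X_t$; $b$ is a blank message (no transmission). **O1.** As long as it has not sent a final message, at time $t$ O1 chooses $Z^1_t=\gamma^1_t(Y^1_{1:t})\in\{0,1,b\}$; $\tau^1=\min\{t: Z^1_t\in\{0,1\}\}\le T^1<\infty$ (at time $T^1$ O1 must send $0$ or $1$ if it has not done so before). A policy is $\Gamma^1=(\gamma^1_1,\dots,\gamma^1_{T^1})$. O1 sends nothing after $\tau^1$ and gets no feedback from O2. **Problem P2.** O2 takes measurements from time $t=1$; at each time $t$, after O1's action at time $t$, O2 (if it has not stopped) chooses $U^2_t=\gamma^2_t(Y^2_{1:t},Z^1_{1:t})\in\{0,1,N\}$, where $N$ means ''continue'' and where for $t>\tau^1$ the sequence $Z^1_{1:t}$ is understood as $Z^1_{1:\tau^1}$. $\tau^2=\min\{t:U^2_t\in\{0,1\}\}\le T^2$, with $T^1\le T^2<\infty$. O2 may stop before O1 does. A policy is $\Gamma^2=(\gamma^2_1,\dots,\gamma^2_{T^2})$. The objective is to minimize $\mathbb{E}^{\Gamma^1,\Gamma^2}\{c^1\tau^1+c^2\tau^2+J(U^2_{\tau^2},H)\}$, where $c^1,c^2$ are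 finite positive numbers, $0\le J\le L<\infty$, $J(0,1)>J(1,1)$ and $J(1,0)>J(0,0)$. **O2's belief.** For fixed $\Gamma^1$, $\pi^2_t=P^{\Gamma^1}(H=0|Y^2_{1:t},Z^1_{1:t})$, and $\pi^2_0=p_0$. If $\alpha_k=\beta_k$ and $\pi^2_k$ equals this common value, the first listed applicable case is used. *)

(* Defs.v *)
(* The hypotheses and the binary decisions 0 and 1 are the
   booleans false and true.  In [action], None is the blank message for O1 and
   the "continue" decision N for O2.  Time starts at 1: the values at index 0
   of the observation sequences and policies are never used. *)
From HB Require Import structures.
From mathcomp Require Export all_boot all_order all_algebra.
From mathcomp Require Export all_classical all_reals all_analysis.
Export Order.TTheory GRing.Theory Num.Theory.
Export numFieldNormedType.Exports.

Set Implicit Arguments.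
Unset Strict Implicit.
Unset Printing Implicit Defensive.

Local Open Scope classical_set_scope.
Local Open Scope ring_scope.

Definition action : Type := option bool.

HB.instance Definition _ := Choice.on action.
HB.instance Definition _ := isPointed.Build action None.
HB.instance Definition _ := @isMeasurable.Build default_measure_display
  action (@discrete_measurable action) (@discrete_measurable0 action)
  (@discrete_measurableC action) (@discrete_measurableU action).

Definition messages : Type := seq action.

HB.instance Definition _ := Choice.on messages.
HB.instance Definition _ := isPointed.Build messages [::].
HB.instance Definition _ := @isMeasurable.Build default_measure_display
  messages (@discrete_measurable messages) (@discrete_measurable0 messages)
  (@discrete_measurableC messages) (@discrete_measurableU messages).

(* The vector (y_1, ..., y_t). *)
Definition prefix (T : Type) (y : nat -> T) (t : nat) : t.-tuple T :=
  [tuple y (val i).+1 | i < t].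

(* min {t : u_t \in {0,1}}, searched among t = 1, ..., T; the value is T.+1
   when there is no such t. *)
Definition stop_time (T : nat) (u : nat -> action) : nat :=
  (find (fun t => isSome (u t)) (iota 1 T)).+1.

Section policies.
Context (Y1 Y2 : Type).

Definition policy1 := forall t : nat, t.-tuple Y1 -> action.
Definition policy2 := forall t : nat, t.-tuple Y2 * messages -> action.

Definition sent (g1 : policy1) (y1 : nat -> Y1) (t : nat) : action :=
  g1 t (prefix y1 t).

Definition tau1 (T1 : nat) (g1 : policy1) (y1 : nat -> Y1) : nat :=
  stop_time T1 (sent g1 y1).

(* Z^1_{1:t}, which is frozen to Z^1_{1:tau1} when t > tau1. *)
Definition received (T1 : nat) (g1 : policy1) (y1 : nat -> Y1) (t : nat) :
    messages :=
  [seq sent g1 y1 s | s <- iota 1 (minn t (tau1 T1 g1 y1))].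

(* The information (Y^2_{1:t}, Z^1_{1:t}) of O2 at time t. *)
Definition info2 (T1 : nat) (g1 : policy1) (y1 : nat -> Y1) (y2 : nat -> Y2)
    (t : nat) : t.-tuple Y2 * messages :=
  (prefix y2 t, received T1 g1 y1 t).

Definition decision2 (T1 : nat) (g1 : policy1) (g2 : policy2)
    (y1 : nat -> Y1) (y2 : nat -> Y2) (t : nat) : action :=
  g2 t (info2 T1 g1 y1 y2 t).

Definition tau2 (T1 T2 : nat) (g1 : policy1) (g2 : policy2)
    (y1 : nat -> Y1) (y2 : nat -> Y2) : nat :=
  stop_time T2 (decision2 T1 g1 g2 y1 y2).

(* For admissible policies U^2_{tau2} is never None, so the default value of
   [odflt] is irrelevant. *)
Definition realized_cost (R : realType) (c1 c2 : R) (J : bool -> bool -> R)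
    (T1 T2 : nat) (g1 : policy1) (g2 : policy2)
    (y1 : nat -> Y1) (y2 : nat -> Y2) (h : bool) : R :=
  let s2 := tau2 T1 T2 g1 g2 y1 y2 in
  c1 * (tau1 T1 g1 y1)%:R + c2 * s2%:R
  + J (odflt false (decision2 T1 g1 g2 y1 y2 s2)) h.

End policies.

(* The conditional laws [law false], [law true] of an observation given H are
   either both discrete, with probability mass functions [p h], or both
   absolutely continuous, with densities [f h] for the reference measure
   [lambda] of the observation space. *)
Definition discrete_or_density (d : measure_display) (Y : measurableType d)
    (R : realType) (lambda : {measure set Y -> \bar R})
    (law : bool -> probability Y R) : Prop :=
  (exists p : bool -> Y -> R,
     (forall h y, 0 <= p h y) /\
     forall h A, measurable A -> law h A = (\esum_(y in A) (p h y)%:E)%E)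
  \/
  (exists f : bool -> Y -> R,
     (forall h, measurable_fun setT (f h)) /\
     (forall h y, 0 <= f h y) /\
     forall h A, measurable A -> law h A = (\int[lambda]_(y in A) (f h y)%:E)%E).

(* Given H = h, the observations Y^i_t (i = 1, 2; t >= 1) are independent with
   laws [law1 t h] and [law2 t h].  The identity is multiplied through by
   P(H = h), so that it is meaningful when the prior is degenerate. *)
Definition observation_model (d d1 d2 : measure_display)
    (Omega : measurableType d) (O1 : measurableType d1)
    (O2 : measurableType d2) (R : realType) (P : probability Omega R)
    (p0 : R) (H : {RV P >-> bool})
    (Y1 : nat -> {RV P >-> O1}) (Y2 : nat -> {RV P >-> O2})
    (law1 : nat -> bool -> probability O1 R)
    (law2 : nat -> bool -> probability O2 R) : Prop :=
  [/\ P (H @^-1` [set false]) = p0%:E,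
      P (H @^-1` [set true]) = (1 - p0)%:E
    & forall (n : nat) (h : bool) (A : nat -> set O1) (B : nat -> set O2),
        (forall t, measurable (A t)) -> (forall t, measurable (B t)) ->
        P [set w | H w = h /\ forall t, (1 <= t <= n)%N ->
                                  A t (Y1 t w) /\ B t (Y2 t w)]
        = (P (H @^-1` [set h])
           * (\prod_(1 <= t < n.+1) law1 t h (A t))
           * (\prod_(1 <= t < n.+1) law2 t h (B t)))%E].

(* [p] is a version of the conditional probability P(E | X): p(X) is
   determined only almost surely. *)
Definition is_cond_prob (d d' : measure_display) (Omega : measurableType d)
    (S : measurableType d') (R : realType) (P : probability Omega R)
    (E : set Omega) (X : Omega -> S) (p : S -> R) : Prop :=
  measurable_fun setT p /\
  forall B : set S, measurable B ->
    (\int[P]_(w in X @^-1` B) (p (X w))%:E)%E = P (E `&` X @^-1` B).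

Section problem_P2.
Context (d d1 d2 : measure_display) (Omega : measurableType d)
  (O1 : measurableType d1) (O2 : measurableType d2) (R : realType)
  (P : probability Omega R).
Variables (H : {RV P >-> bool})
  (Y1 : nat -> {RV P >-> O1}) (Y2 : nat -> {RV P >-> O2}).

Definition admissible1 (T1 : nat) (g1 : policy1 O1) : Prop :=
  (forall t, (1 <= t <= T1)%N -> measurable_fun setT (g1 t)) /\
  (forall w, (tau1 T1 g1 (Y1 ^~ w) <= T1)%N).

Definition admissible2 (T1 T2 : nat) (g1 : policy1 O1) (g2 : policy2 O2) :
    Prop :=
  (forall t, (1 <= t <= T2)%N -> measurable_fun setT (g2 t)) /\
  (forall w, (tau2 T1 T2 g1 g2 (Y1 ^~ w) (Y2 ^~ w) <= T2)%N).

Definition expected_cost (c1 c2 : R) (J : bool -> bool -> R) (T1 T2 : nat)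
    (g1 : policy1 O1) (g2 : policy2 O2) : \bar R :=
  ('E_P[fun w => realized_cost c1 c2 J T1 T2 g1 g2
                   (Y1 ^~ w) (Y2 ^~ w) (H w)])%E.

Definition optimal2 (c1 c2 : R) (J : bool -> bool -> R) (T1 T2 : nat)
    (g1 : policy1 O1) (g2 : policy2 O2) : Prop :=
  admissible2 T1 T2 g1 g2 /\
  forall g2' : policy2 O2, admissible2 T1 T2 g1 g2' ->
    (expected_cost c1 c2 J T1 T2 g1 g2
     <= expected_cost c1 c2 J T1 T2 g1 g2')%E.

(* [pi t] is a version of P(H = 0 | Y^2_{1:t}, Z^1_{1:t}).  For t = 0 the
   information is trivial and this says pi^2_0 = p0. *)
Definition is_belief2 (T1 T2 : nat) (g1 : policy1 O1)
    (pi : forall t : nat, t.-tuple O2 * messages -> R) : Prop :=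
  forall t, (t <= T2)%N ->
    is_cond_prob P (H @^-1` [set false])
      (fun w => info2 T1 g1 (Y1 ^~ w) (Y2 ^~ w) t) (pi t).

End problem_P2.

(* Main.v *)
From HB Require Import structures.
Require Import Defs.
From mathcomp Require Import measurable_realfun ring lra.

Set Implicit Arguments.
Unset Strict Implicit.
Unset Printing Implicit Defensive.

Local Open Scope classical_set_scope.
Local Open Scope ring_scope.

(** Given O1's policy, O2 faces an optimal stopping problem whose state at time
    [k] is the pair formed by the messages [z] received so far and the belief
    [p] that H is 0.  Backward induction gives a value function [value]: with
    [n] further decision times left, it is the least of the costs of announcing
    0, of announcing 1 and (if [n > 0]) of waiting.  As a function of [p], the
    first two are affine, and the third is concave, because it is an average of
    next-step values, hence of minima of linear functions.  Announcing 1 is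
    best at [p = 0] and announcing 0 is best at [p = 1]; the set where a
    concave function stays above an affine one is an interval, so the beliefs
    at which one announces 1 form an interval [[0, alpha]], those at which one
    announces 0 an interval [[beta, 1]], and one waits in between
    ([concave_stopping_thresholds], [stopping_thresholds]).

    The state really is [(z, p)] because, given H, O1's messages depend on O1's
    observations only: given H and the messages received up to time [k], the
    next signal (O2's next observation with the next message list) is
    independent of O2's past observations ([signal_indep]).  The past therefore
    enters the law of the next signal only through the weights [p], [1 - p] of
    the two hypotheses, while the two conditional laws depend on [z] alone.

    Costs are written as functions [v p q] of unnormalised weights of the two
    hypotheses, homogeneous of degree one.  Homogeneity absorbs the normalising
    constant of Bayes' rule: the expectation of [v] at the posterior belief is
    the integral of [v (p * F0) (q * F1)], where F0 and F1 are the densities of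
    the next signal under the two hypotheses ([bayes_homogeneous]).  For
    homogeneous functions concavity is superadditivity, which passes through
    integrals and minima ([pcost_continuation], [pcost_min]).

    The belief is an arbitrary version of a conditional probability, so all
    comparisons are made after integration over events of O2's information.
    The cost of any policy is bounded below by the integral of the value
    function, with equality when each decision attains the minimum that defines
    it ([run_cost_value]); the threshold policy does so. *)

(** * Measures, images and densities *)

Lemma measurable_preimage d d' (T : measurableType d) (S : measurableType d')
    (f : T -> S) A :
  measurable_fun setT f -> measurable A -> measurable (f @^-1` A).
Proof. by move=> mf mA; rewrite -[X in measurable X]setTI; exact: mf. Qed.

Section image_measure.
Context d d' (T : measurableType d) (S : measurableType d') (R : realType).
Variables (mu : {finite_measure set T -> \bar R}) (f : T -> S).
Hypothesis mf : measurable_fun setT f.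

(** The pushforward, with the measurability of the map as an argument: this lets
    a term carry the canonical structure of finite measure. *)
Definition image_measure (_ : measurable_fun setT f) : set S -> \bar R :=
  pushforward mu f.

Local Notation im := (image_measure mf).

Let im0 : im set0 = 0%E.
Proof. by rewrite /image_measure /pushforward preimage_set0 measure0. Qed.

Let im_ge0 A : (0 <= im A)%E. Proof. exact: measure_ge0. Qed.

Let im_sigma_additive : semi_sigma_additive im.
Proof.
exact: (@measure_semi_sigma_additive _ _ _ [the measure _ _ of pushforward mu f]).
Qed.

HB.instance Definition _ := isMeasure.Build _ _ _ im im0 im_ge0 im_sigma_additive.

Let im_fin : fin_num_fun im.
Proof.
move=> A mA; apply: fin_num_measure.
by rewrite -[X in measurable X]setTI; exact: mf.
Qed.

HB.instance Definition _ := Measure_isFinite.Build _ _ _ im im_fin.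

Lemma ge0_integral_image_measure (g : S -> \bar R) A :
  measurable A -> measurable_fun A g -> (forall x, 0 <= g x)%E ->
  (\int[im]_(x in A) g x = \int[mu]_(w in f @^-1` A) g (f w))%E.
Proof. by move=> mA mg g0; rewrite ge0_integral_pushforward. Qed.

End image_measure.

(** Normalising, then multiplying back by the total mass, is the identity even
    when the mass is 0 and the normalisation is an arbitrary probability. *)
Lemma mul_mnormalize d (T : measurableType d) (R : realType)
    (mu : {finite_measure set T -> \bar R}) (P : probability T R) A :
  measurable A -> (mu setT * mnormalize mu P A = mu A)%E.
Proof.
move=> mA; rewrite /mnormalize /=.
have muT : mu setT \is a fin_num by exact: fin_num_measure.
have [mu0|mu0] := eqVneq (mu setT) 0%E.
  rewrite mu0 mul0e; apply/esym/eqP; rewrite eq_le measure_ge0 andbT -mu0.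
  by apply: le_measure; rewrite ?inE.
have /negbTE -> /= : mu setT != +oo%E by rewrite -ltey ltey_eq muT.
rewrite muleCA -[X in (_ * (X * _))%E](fineK muT) -EFinM divff ?mule1//.
by rewrite fine_eq0.
Qed.

Section densities.
Context d (T : measurableType d) (R : realType).

Section finite_measure_add.
Variables m1 m2 : {finite_measure set T -> \bar R}.

(** A reference measure for a pair of laws: each is dominated by the sum. *)
Definition measure_sum : set T -> \bar R := measure_add m1 m2.

HB.instance Definition _ := Measure.copy measure_sum
  [the measure _ _ of measure_add m1 m2].

Let fin_measure_sum : fin_num_fun measure_sum.
Proof.
by move=> A mA; rewrite /measure_sum measure_addE fin_numD !fin_num_measure.
Qed.

HB.instance Definition _ :=
  Measure_isFinite.Build _ _ _ measure_sum fin_measure_sum.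

End finite_measure_add.

(** A density agrees almost everywhere with the Radon-Nikodym derivative, for
    which change of variables holds. *)
Lemma ge0_integral_density (mu : {sigma_finite_measure set T -> \bar R})
    (nu : {finite_measure set T -> \bar R}) (h : T -> R) :
  measurable_fun setT h -> (forall x, 0 <= h x) ->
  (forall A, measurable A -> nu A = \int[mu]_(x in A) (h x)%:E)%E ->
  forall f : T -> \bar R, measurable_fun setT f -> (forall x, 0 <= f x)%E ->
  (\int[nu]_x f x = \int[mu]_x (f x * (h x)%:E))%E.
Proof.
move=> mh h0 hE f mf f0.
have numu : nu `<< mu.
  apply/null_content_dominatesP => A mA muA0; rewrite hE//.
  by apply: null_set_integral => //; exact/measurable_funTS/measurable_EFinP.
have mEh : measurable_fun setT (EFin \o h) by exact/measurable_EFinP.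
have ih : mu.-integrable setT (EFin \o h).
  apply/integrableP; split => //.
  under eq_integral do rewrite /= ger0_norm//.
  by rewrite -hE// ltey_eq fin_num_measure.
have ae : ae_eq mu setT (EFin \o h) (Radon_Nikodym_SigmaFinite.f nu mu).
  apply: integral_ae_eq => //.
    exact: measurable_int (Radon_Nikodym_SigmaFinite.f_integrable numu).
  by move=> E _ mE; rewrite -hE// (Radon_Nikodym_SigmaFinite.f_integral numu).
rewrite -(Radon_Nikodym_SigmaFinite.change_of_variables numu)//.
apply: ae_eq_integral => //.
- apply: emeasurable_funM => //.
  exact: measurable_int (Radon_Nikodym_SigmaFinite.f_integrable numu).
- exact: emeasurable_funM.
- apply: filterS ae => x /(_ I) /= <- //.
Qed.

(** A Radon-Nikodym theorem that covers discrete laws and laws with a density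
    alike, and that gives densities with finite values. *)
Lemma common_density (kappa : bool -> probability T R) :
  exists F : bool -> T -> R,
  [/\ forall h, measurable_fun setT (F h), forall h x, 0 <= F h x &
      forall h A, measurable A -> (kappa h A =
        \int[measure_sum (kappa false) (kappa true)]_(x in A) (F h x)%:E)%E].
Proof.
pose nu : {finite_measure set T -> \bar R} :=
  measure_sum (kappa false) (kappa true).
have dom h : kappa h `<< nu.
  apply/null_content_dominatesP => A mA; rewrite /nu /= /measure_sum measure_addE.
  move=> /eqP; rewrite padde_eq0 ?measure_ge0// => /andP[/eqP ? /eqP ?].
  by case: h.
exists (fun h => fine \o Radon_Nikodym_SigmaFinite.f (kappa h) nu).
have fE h x : (fine (Radon_Nikodym_SigmaFinite.f (kappa h) nu x))%:E =
    Radon_Nikodym_SigmaFinite.f (kappa h) nu x.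
  by rewrite fineK//; exact: Radon_Nikodym_SigmaFinite.f_fin_num (dom h) x.
split => [h|h x|h A mA].
- apply: measurableT_comp => //.
  exact: measurable_int (Radon_Nikodym_SigmaFinite.f_integrable (dom h)).
- by rewrite /= fine_ge0//; exact: Radon_Nikodym_SigmaFinite.f_ge0 (dom h) x.
- by under eq_integral do rewrite fE; rewrite (Radon_Nikodym_SigmaFinite.f_integral (dom h)).
Qed.

End densities.

(** * Bayes' rule inside a homogeneous function *)

(** The probability of hypothesis [h] when the belief in H = 0 is [p]. *)
Definition weight (R : realType) (h : bool) (p : R) : R :=
  if h then 1 - p else p.

Lemma weight_ge0 (R : realType) h (p : R) : 0 <= p <= 1 -> 0 <= weight h p.
Proof. by case/andP => p0 p1; case: h => //=; rewrite subr_ge0. Qed.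

Lemma measurable_weight (R : realType) d (T : measurableType d) h (f : T -> R) :
  measurable_fun setT f -> measurable_fun setT (fun x => weight h (f x)).
Proof. by case: h => // mf; exact: measurable_funB. Qed.

Lemma preimage_bool_measurable d (T : measurableType d) (H : T -> bool) h :
  measurable_fun setT H -> measurable (H @^-1` [set h]).
Proof. by move=> mH; rewrite -[X in measurable X]setTI; exact: mH. Qed.

Section bayes.
Local Open Scope ereal_scope.
Context d d1 d2 (Om : measurableType d) (T : measurableType d1)
  (S : measurableType d2) (R : realType).
Variables (P : {finite_measure set Om -> \bar R}) (H : Om -> bool)
  (Y : Om -> T) (s : Om -> S).
Hypotheses (mH : measurable_fun setT H) (mY : measurable_fun setT Y)
  (ms : measurable_fun setT s).
Variables (kappa : bool -> probability S R)
  (nu : {finite_measure set S -> \bar R}) (F : bool -> S -> R).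
Hypotheses (mF : forall h, measurable_fun setT (F h))
  (F0 : forall h x, (0 <= F h x)%R)
  (FE : forall h A, measurable A ->
     kappa h A = \int[nu]_(x in A) (F h x)%:E).
(* Given H, the new signal [s] has law [kappa] and is independent of the past
   [Y]. *)
Hypothesis indep : forall h A B, measurable A -> measurable B ->
  P (H @^-1` [set h] `&` (Y @^-1` A `&` s @^-1` B)) =
  P (H @^-1` [set h] `&` Y @^-1` A) * kappa h B.

(* [f] is a version of the belief in H = 0 given [X]; since [P] need not be a
   probability, everything may happen on a fixed event. *)
Local Notation post f X := (forall A, measurable A ->
  \int[P]_(w in X @^-1` A) (f (X w))%:E =
  P (H @^-1` [set false] `&` X @^-1` A)).

Lemma posterior_weight d' (U : measurableType d') (X : Om -> U) (f : U -> R) :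
  measurable_fun setT X -> measurable_fun setT f ->
  (forall x, 0 <= f x <= 1)%R -> post f X ->
  forall h A, measurable A -> \int[P]_(w in X @^-1` A) (weight h (f (X w)))%:E =
    P (H @^-1` [set h] `&` X @^-1` A).
Proof.
move=> mX mf f01 fpost [] A mA; last exact: fpost.
have mXA : measurable (X @^-1` A).
  by rewrite -[X in measurable X]setTI; exact: mX.
have mfX : measurable_fun (X @^-1` A) (fun w => (f (X w))%:E).
  by apply/measurable_funTS/measurable_EFinP; exact: measurableT_comp.
have fin : P (H @^-1` [set false] `&` X @^-1` A) \is a fin_num.
  by rewrite fin_num_measure//; apply: measurableI => //;
    exact: preimage_bool_measurable.
rewrite -[LHS](addeK _ fin) -[RHS](addeK _ fin); congr (_ - _).
rewrite -{1}fpost// -ge0_integralD//=.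
- under eq_integral do rewrite -EFinD subrK.
  rewrite integral_cst// mul1e -measureU.
  + rewrite -setIUl; congr (P _); apply/seteqP; split => [w Xw|w []//].
    by split => //=; case: (H w); [left|right].
  + by apply: measurableI => //; exact: preimage_bool_measurable.
  + by apply: measurableI => //; exact: preimage_bool_measurable.
  + by apply/seteqP; split => // w /= [[-> _] []].
- by move=> w _; rewrite lee_fin (@weight_ge0 _ true).
- apply/measurable_funTS/measurable_EFinP; apply: measurable_funB => //.
  exact: measurableT_comp.
- by move=> w _; rewrite lee_fin; case/andP: (f01 (X w)).
Qed.

Variables (a : T -> R) (b : T * S -> R) (v : S -> R -> R -> R).
Hypotheses (ma : measurable_fun setT a) (a01 : forall y, (0 <= a y <= 1)%R)
  (apost : post a Y).
Hypotheses (mb : measurable_fun setT b) (b01 : forall x, (0 <= b x <= 1)%R)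
  (bpost : post b (fun w => (Y w, s w))).
Hypotheses
  (mv : measurable_fun setT (fun x : S * (R * R) => v x.1 x.2.1 x.2.2))
  (v0 : forall x (p q : R), (0 <= p -> 0 <= q -> 0 <= v x p q)%R)
  (vZ : forall x (c p q : R), (0 <= c -> 0 <= p -> 0 <= q ->
    v x (c * p) (c * q) = c * v x p q)%R).

Let mE h : measurable (H @^-1` [set h]).
Proof. exact: preimage_bool_measurable. Qed.

Let mYs : measurable_fun setT (fun w => (Y w, s w)).
Proof. exact: measurable_fun_pair. Qed.

Let mu := image_measure P mY.
Let muh h := image_measure (mrestr P (mE h)) mY.
Let Q := image_measure P mYs.
Let Qh h := image_measure (mrestr P (mE h)) mYs.
Let n h (z : T * S) : R := (weight h (a z.1) * F h z.2)%R.

Let mn h : measurable_fun setT (n h).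
Proof.
apply: measurable_funM; last exact: measurableT_comp.
by apply: measurable_weight; exact: measurableT_comp.
Qed.

Let n0 h z : (0 <= n h z)%R.
Proof. by rewrite mulr_ge0// weight_ge0. Qed.

(* Under hypothesis [h], the pair (past, signal) has density [n h] for the
   product of the law of the past and of [nu].  It suffices to test this on
   rectangles, where it is conditional independence. *)
Let integral_Qh h (f : T * S -> \bar R) : measurable_fun setT f ->
  (forall z, 0 <= f z) ->
  \int[Qh h]_z f z = \int[mu \x nu]_z (f z * (n h z)%:E).
Proof.
move=> mf f0.
have mFh y : measurable_fun setT (fun x => f (y, x) * (F h x)%:E).
  apply: emeasurable_funM; last exact/measurable_EFinP.
  exact: measurableT_comp.
rewrite (eq_measure_integral (muh h \x kappa h)); last first.
  move=> A mA _; apply/esym; apply: product_measure_unique => // B C mB mC.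
  rewrite /Qh /muh /= /image_measure /pushforward /mrestr/=.
  by rewrite setIC (setIC (Y @^-1` B)) -indep.
rewrite fubini_tonelli1//.
rewrite (@ge0_integral_density _ _ _ mu (muh h) (fun y => weight h (a y))).
- rewrite fubini_tonelli1//=; last 2 first.
  + apply: emeasurable_funM => //; exact/measurable_EFinP.
  + by move=> z; rewrite mule_ge0// lee_fin.
  apply: eq_integral => y _; rewrite /fubini_F/=.
  rewrite (@ge0_integral_density _ _ _ nu (kappa h) (F h))//;
    [|exact: FE|exact: measurableT_comp].
  rewrite muleC -ge0_integralZl//.
  + by apply: eq_integral => x _; rewrite /n/= EFinM muleCA.
  + by move=> x _; rewrite mule_ge0// lee_fin.
  + by rewrite lee_fin weight_ge0.
- exact: measurable_weight.
- by move=> y; exact: weight_ge0.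
- move=> A mA; rewrite /mu ge0_integral_image_measure//.
  + rewrite (posterior_weight mY ma a01 apost)//.
    by rewrite /muh/= /image_measure/= /pushforward /mrestr setIC.
  + by apply/measurable_funTS/measurable_EFinP; exact: measurable_weight.
  + by move=> y; rewrite lee_fin weight_ge0.
- exact: measurable_fun_fubini_tonelli_F.
- by move=> y; apply: integral_ge0 => x _.
Qed.

Let integral_Q (f : T * S -> \bar R) (D : set (T * S)) : measurable D ->
  measurable_fun setT f -> (forall z, 0 <= f z) ->
  \int[Q]_(z in D) f z =
  \int[mu \x nu]_(z in D) (f z * (n false z + n true z)%:E).
Proof.
move=> mD mf f0; rewrite integral_mkcond.
have mfD : measurable_fun setT (f \_ D) by apply/(measurable_restrictT _ _).1 => //; exact/measurable_funTS.
have fD0 z : 0 <= (f \_ D) z by rewrite patchE; case: ifP.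
rewrite (eq_measure_integral (measure_sum (Qh false) (Qh true))); last first.
  move=> A mA _; rewrite /= /measure_sum measure_addE.
  rewrite /Q/= /Qh /= /image_measure /pushforward /mrestr /=.
  rewrite -measureU.
  - rewrite -setIUr; congr (P _); apply/seteqP; split => [w Aw|w []//].
    by split => //=; case: (H w); [right|left].
  - by apply: measurableI => //; rewrite -[X in measurable X]setTI; exact: mYs.
  - by apply: measurableI => //; rewrite -[X in measurable X]setTI; exact: mYs.
  - by apply/seteqP; split => // w /= [[_ ->] []].
rewrite ge0_integral_measure_add// !integral_Qh// -ge0_integralD//.
- rewrite [RHS]integral_mkcond; apply: eq_integral => z _.
  rewrite !patchE; case: ifP => _; last by rewrite !mul0e adde0.
  by rewrite EFinD ge0_muleDr// lee_fin.
- by move=> z _; rewrite mule_ge0// lee_fin.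
- apply: emeasurable_funM => //; exact/measurable_EFinP.
- by move=> z _; rewrite mule_ge0// lee_fin.
- apply: emeasurable_funM => //; exact/measurable_EFinP.
Qed.

(* Bayes' rule in unnormalised form: both sides have the same integral on every
   event of the pair (past, signal). *)
Let b_unnormalized : ae_eq (mu \x nu) setT
  (fun z => (n false z)%:E) (fun z => (b z * (n false z + n true z))%:E).
Proof.
have mfn : measurable_fun setT (fun z => (n false z)%:E).
  exact/measurable_EFinP.
have intE E : measurable E ->
    \int[mu \x nu]_(z in E) (n false z)%:E = Qh false E.
  move=> mE'; transitivity (\int[Qh false]_z (\1_E z)%:E); last first.
    by rewrite integral_indic// setIT.
  rewrite integral_Qh//.
  - rewrite integral_mkcond; apply: eq_integral => z _.
    by rewrite patchE indicE; case: ifP; rewrite ?mul1e ?mul0e.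
  - exact/measurable_EFinP.
apply: integral_ae_eq => //.
- apply/integrableP; split => //.
  under eq_integral do rewrite gee0_abs ?lee_fin//.
  by rewrite intE// ltey_eq fin_num_measure.
- by apply/measurable_EFinP/measurable_funM => //; exact: measurable_funD.
- move=> E _ mE'; rewrite intE//.
  under [RHS]eq_integral do rewrite EFinM.
  rewrite -(integral_Q (f := fun z => (b z)%:E))//.
  + rewrite /Q ge0_integral_image_measure//.
    * rewrite bpost// /Qh /= /image_measure /pushforward /mrestr/=.
      by rewrite setIC.
    * by apply/measurable_funTS/measurable_EFinP.
    * by move=> z; rewrite lee_fin; case/andP: (b01 z).
  + exact/measurable_EFinP.
  + by move=> z; rewrite lee_fin; case/andP: (b01 z).
Qed.

(** The belief [b] after the signal satisfies b (n0 + n1) = n0, where n0, n1 are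
    the densities of (past, signal) under the two hypotheses.  Integrating
    against the density n0 + n1 and moving this factor inside the homogeneous
    function [v] replaces the posterior weights by n0 and n1, which no longer
    mention [b]; Fubini then integrates the signal out.  This is why the
    expected next value is a function of the current belief. *)
Lemma bayes_homogeneous A : measurable A ->
  \int[P]_(w in Y @^-1` A)
    (v (s w) (weight false (b (Y w, s w))) (weight true (b (Y w, s w))))%:E =
  \int[P]_(w in Y @^-1` A)
    \int[nu]_x (v x (weight false (a (Y w)) * F false x)
                    (weight true (a (Y w)) * F true x))%:E.
Proof.
move=> mA.
have mAS : measurable (A `*` [set: S]) by exact: measurableX.
have mvf (p q : T * S -> R) : measurable_fun setT p -> measurable_fun setT q ->
    measurable_fun setT (fun z : T * S => (v z.2 (p z) (q z))%:E).
  move=> mp mq; apply/measurable_EFinP.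
  apply: (measurableT_comp mv (g := fun z : T * S => (z.2, (p z, q z)))).
  by apply: measurable_fun_pair => //; exact: measurable_fun_pair.
have mvn : measurable_fun setT
    (fun z : T * S => (v z.2 (n false z) (n true z))%:E) by exact: mvf.
have vn0 z : 0 <= (v z.2 (n false z) (n true z))%:E by rewrite lee_fin v0.
have mvb : measurable_fun setT (fun z : T * S =>
    (v z.2 (weight false (b z)) (weight true (b z)))%:E).
  by apply: mvf; exact: measurable_weight.
have vb0 z : 0 <= (v z.2 (weight false (b z)) (weight true (b z)))%:E.
  by rewrite lee_fin v0// weight_ge0.
transitivity (\int[Q]_(z in A `*` setT)
    (v z.2 (weight false (b z)) (weight true (b z)))%:E).
  rewrite /Q ge0_integral_image_measure//; last exact: measurable_funTS.
  congr (integral _ _ _); apply/seteqP; split => [w //|w []//].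
rewrite integral_Q//.
transitivity (\int[mu \x nu]_(z in A `*` setT)
    (v z.2 (n false z) (n true z))%:E).
  apply: ge0_ae_eq_integral => //.
  - apply: measurable_funTS; apply: emeasurable_funM => //.
    by apply/measurable_EFinP; exact: measurable_funD.
  - exact: measurable_funTS.
  - by move=> z _; rewrite mule_ge0// lee_fin addr_ge0.
  - apply: filterS b_unnormalized => z /(_ I) [bn] _.
    have nn0 : (0 <= n false z + n true z)%R by rewrite addr_ge0.
    have bt : (weight true (b z) * (n false z + n true z) = n true z)%R.
      by rewrite /= mulrBl mul1r -bn addrAC subrr add0r.
    rewrite -EFinM mulrC -vZ ?weight_ge0// ![(_ * weight _ _)%R]mulrC bt.
    by rewrite /= -bn.
rewrite integral_mkcond fubini_tonelli1//=; last 2 first.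
- by apply/(measurable_restrictT _ _).1 => //; exact: measurable_funTS.
- by move=> z; rewrite patchE; case: ifP.
rewrite -(@ge0_integral_image_measure _ _ _ _ _ P Y mY
  (fubini_F nu (fun z => (v z.2 (n false z) (n true z))%:E)) A)//.
- rewrite [RHS]integral_mkcond; apply: eq_integral => y _.
  rewrite patchE /fubini_F; case: ifPn => [/set_mem Ay|/negP Ay].
    by apply: eq_integral => x _; rewrite patchE mem_set.
  rewrite integral0_eq// => x _; rewrite patchE memNset//.
  by case => /mem_set.
- by apply: measurable_funTS; exact: measurable_fun_fubini_tonelli_F.
- by move=> y; apply: integral_ge0.
Qed.

End bayes.

(** * Thresholds of a concave stopping problem *)

Definition concave01 (R : realType) (D : R -> R) : Prop :=
  forall t p q, 0 <= t <= 1 -> 0 <= p <= 1 -> 0 <= q <= 1 ->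
    t * D p + (1 - t) * D q <= D (t * p + (1 - t) * q).

Section thresholds.
Context (R : realType).
Implicit Types (D W : R -> R) (p c : R).

(** A concave function that is nonnegative at 0 stays so up to some point and is
    negative afterwards.  The point is a supremum; it is attained because
    concavity between the points [x] below the supremum and the end point 1
    prevents the function from jumping down at an interior point.  This is
    where [c < 1] is needed: a concave function may jump down at 1. *)
Lemma concave01_last_nonneg D c : concave01 D -> 0 <= D 0 -> 0 <= c < 1 ->
  exists alpha, [/\ 0 <= alpha <= c, forall p, 0 <= p <= alpha -> 0 <= D p &
    forall p, alpha < p <= c -> D p < 0].
Proof.
move=> cD D0 /andP[c0 c1].
pose A : set R := [set p | 0 <= p <= c /\ 0 <= D p].
have A0 : A 0 by split => //; rewrite lexx.
have ubA : ubound A c by move=> p [/andP[]].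
have supA : has_sup A by split; [exists 0 | exists c].
have ubsup : ubound A (sup A) by exact: ub_le_sup supA.2.
set alpha := sup A.
have a0 : 0 <= alpha by exact: ubsup.
have ac : alpha <= c by apply: ge_sup => //; exists 0.
have Da : 0 <= D alpha.
  rewrite leNgt; apply/negP => Da.
  (* concavity at [alpha], between [x] and 1, cleared of denominators *)
  have key x : A x -> - D alpha * (1 - alpha) <= (alpha - x) * (- D 1).
    move=> Ax; have xa : x <= alpha := ubsup _ Ax; case: Ax => /andP[x0 xc] Dx.
    have x1 : 0 < 1 - x by lra.
    have := cD ((1 - alpha) / (1 - x)) x 1.
    rewrite x0 ler01 lexx (le_trans xc (ltW c1)) => /(_ _ isT isT).
    have -> : 0 <= (1 - alpha) / (1 - x) <= 1.
      rewrite divr_ge0 ?ler_pdivrMr//=; lra.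
    have -> : (1 - alpha) / (1 - x) * x + (1 - (1 - alpha) / (1 - x)) * 1 = alpha.
      by field; rewrite gt_eqF.
    move=> /(_ isT) le1.
    have {le1} : (1 - alpha) * D x + (alpha - x) * D 1 <= D alpha * (1 - x).
      rewrite -ler_pdivrMr//; apply: le_trans le1.
      rewrite le_eqVlt; apply/orP; left; apply/eqP; field.
      by rewrite gt_eqF.
    have := mulr_ge0 (_ : 0 <= 1 - alpha) Dx.
    have : 0 <= - D alpha * (alpha - x) by rewrite mulr_ge0; lra.
    nra.
  have D1 : 0 < - D 1.
    have agt0 : 0 < alpha.
      by rewrite lt0r a0 andbT; apply/eqP => a00; rewrite a00 in Da; lra.
    have h1 : 0 < - D alpha * (1 - alpha) by rewrite mulr_gt0; lra.
    by have := lt_le_trans h1 (key 0 A0); rewrite subr0 pmulr_rgt0.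
  (* by [key], every point of [A] is at least [delta] below the supremum *)
  pose delta := - D alpha * (1 - alpha) / (- D 1).
  have d0 : 0 < delta by rewrite divr_gt0// mulr_gt0; lra.
  have : alpha <= alpha - delta.
    apply: ge_sup; first by exists 0.
    move=> x Ax; have := key x Ax; rewrite -ler_pdivrMr// -/delta; lra.
  lra.
exists alpha; split; first by rewrite a0.
- move=> p /andP[p0 pa]; have [a00|an0] := eqVneq alpha 0.
    by have -> : p = 0 by lra.
  have agt0 : 0 < alpha by lra.
  have := cD (p / alpha) alpha 0.
  rewrite a0 lexx ler01 (le_trans ac (ltW c1)) => /(_ _ isT isT).
  rewrite divr_ge0 ?ler_pdivrMr ?mul1r ?pa//= => /(_ isT).
  rewrite mulr0 addr0 divfK//; apply: le_trans.
  apply: addr_ge0; apply: mulr_ge0 => //; first exact: divr_ge0.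
  by rewrite subr_ge0 ler_pdivrMr// mul1r.
- move=> p /andP[ap pc]; rewrite ltNge; apply/negP => Dp.
  have : p <= alpha by apply: ubsup; split; rewrite // pc andbT (le_trans a0)// ltW.
  by rewrite leNgt ap.
Qed.

Section two_decisions.
Variables (A B : bool -> R).
Hypotheses (AE : A false < A true) (BE : B true < B false).
Let s u p := p * A u + (1 - p) * B u.

(** The difference of the two costs is affine and increasing in the belief, and
    changes sign at the ratio used as a witness. *)
Lemma indifference_belief : exists c, [/\ 0 < c < 1,
  forall p, p <= c -> s true p <= s false p &
  forall p, c <= p -> s false p <= s true p].
Proof.
pose c := (B false - B true) / (B false - B true + (A true - A false)).
have den0 : 0 < B false - B true + (A true - A false) by rewrite addr_gt0 ?subr_gt0.
have c0 : 0 < c by rewrite divr_gt0// subr_gt0.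
have c1 : c < 1 by rewrite ltr_pdivrMr// mul1r ltrDl subr_gt0.
have cE : c * (B false - B true + (A true - A false)) = B false - B true.
  by rewrite divfK// gt_eqF.
exists c; split; first by rewrite c0.
- by move=> p pc; rewrite /s; have := ler_wpM2r (ltW den0) pc; lra.
- by move=> p pc; rewrite /s; have := ler_wpM2r (ltW den0) pc; lra.
Qed.

(** [alpha] is the last belief, below the indifference point [c], at which
    announcing 1 is no worse than waiting.  [beta] is the first belief above
    [c] at which announcing 0 is no worse than waiting, found by applying
    [concave01_last_nonneg] to the reflected function on [[0, 1 - c]].  Hence
    alpha <= c <= beta, and between them waiting beats both announcements. *)
Lemma concave_stopping_thresholds W : concave01 W ->
  B true <= W 0 -> A false <= W 1 ->
  exists alpha beta, [/\ 0 <= alpha, alpha <= beta, beta <= 1, alpha < 1 &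
    forall p, 0 <= p <= 1 ->
      if p <= alpha then s true p <= Num.min (s false p) (W p)
      else if p < beta then W p <= Num.min (s false p) (s true p)
      else s false p <= Num.min (s true p) (W p)].
Proof.
move=> cW W0 W1; have [c [/andP[c0 c1] s_le s_ge]] := indifference_belief.
have concB u : concave01 (fun p => W p - s u p).
  move=> t p q t01 p01 q01; have := cW t p q t01 p01 q01; rewrite /s; lra.
have [|/=|a [/andP[a0 ac] Da Da']] :=
    @concave01_last_nonneg (fun p => W p - s true p) c (concB true).
- by rewrite /s; lra.
- by rewrite ltW.
have [||/=|b [/andP[b0 bc] Db Db']] :=
    @concave01_last_nonneg (fun p => W (1 - p) - s false (1 - p)) (1 - c).
- move=> t p q t01 p01 q01.
  have -> : 1 - (t * p + (1 - t) * q) = t * (1 - p) + (1 - t) * (1 - q) by ring.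
  by apply: (concB false) => //; lra.
- by rewrite /s subr0; lra.
- lra.
exists a, (1 - b); split; [by []|lra|lra|lra|].
move=> p /andP[p0 p1].
case: ifPn => [pa|]; [|rewrite -ltNge => ap; case: ifPn => [pb|]].
- rewrite le_min s_le/= ?(le_trans pa ac)// -subr_ge0.
  by apply: Da; rewrite p0.
- have [pc|cp] := leP p c.
    have Wlt : W p - s true p < 0 by apply: Da'; rewrite ap.
    have := s_le _ pc; rewrite le_min => ?; apply/andP; split; lra.
  have : W (1 - (1 - p)) - s false (1 - (1 - p)) < 0 by apply: Db'; lra.
  have := s_ge _ (ltW cp); rewrite subKr le_min => ? ?; apply/andP; split; lra.
- rewrite -leNgt => bp; rewrite le_min s_ge/=; last by lra.
  have : 0 <= W (1 - (1 - p)) - s false (1 - (1 - p)) by apply: Db; lra.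
  by rewrite subKr subr_ge0.
Qed.

End two_decisions.

End thresholds.

(** * Costs as functions of unnormalised beliefs *)

(** A cost as a function of nonnegative unnormalised weights of H = 0 and H = 1.
    Homogeneity and superadditivity together say that it is the perspective of
    a concave function of the belief.  The lower bound [A], [B] is what
    guarantees that waiting never beats a certain correct announcement; the
    upper bound makes integrals finite. *)
Record perspective_cost (R : realType) (A B C : R) (v : R -> R -> R) : Prop :=
  PerspectiveCost {
  pcost_measurable : measurable_fun setT (fun x : R * R => v x.1 x.2);
  pcost_ge : forall p q : R, 0 <= p -> 0 <= q -> p * A + q * B <= v p q;
  pcost_le : forall p q : R, 0 <= p -> 0 <= q -> v p q <= C * (p + q);
  pcostZ : forall c p q : R, 0 <= c -> 0 <= p -> 0 <= q ->
    v (c * p) (c * q) = c * v p q;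
  pcostD : forall p q p' q' : R, 0 <= p -> 0 <= q -> 0 <= p' -> 0 <= q' ->
    v p q + v p' q' <= v (p + p') (q + q') }.

Section perspective_cost_theory.
Context (R : realType) (A B C : R).
Implicit Types v : R -> R -> R.

Lemma pcost_linear A' B' : A <= A' <= C -> B <= B' <= C ->
  perspective_cost A B C (fun p q => p * A' + q * B').
Proof.
move=> /andP[AA' A'C] /andP[BB' B'C]; split.
- by apply: measurable_funD; apply: measurable_funM.
- by move=> p q p0 q0; rewrite lerD ?ler_wpM2l.
- by move=> p q p0 q0; rewrite mulrDr lerD// mulrC ler_wpM2r.
- by move=> *; ring.
- by move=> *; rewrite le_eqVlt; apply/orP; left; apply/eqP; ring.
Qed.

Lemma pcost_min C' v v' : perspective_cost A B C v ->
  perspective_cost A B C' v' ->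
  perspective_cost A B C (fun p q => Num.min (v p q) (v' p q)).
Proof.
move=> [mv gev lev vZ vD] [mv' gev' _ vZ' vD']; split.
- exact: measurable_minr.
- by move=> p q p0 q0; rewrite le_min gev ?gev'.
- by move=> p q p0 q0; rewrite ge_min lev.
- by move=> c p q c0 p0 q0; rewrite vZ ?vZ'// minr_pMr.
- move=> p q p' q' p0 q0 p0' q0'; rewrite le_min; apply/andP; split.
  + by apply: le_trans (vD _ _ _ _ p0 q0 p0' q0'); rewrite lerD// ge_min lexx.
  + by apply: le_trans (vD' _ _ _ _ p0 q0 p0' q0'); rewrite lerD// ge_min lexx orbT.
Qed.

Lemma pcost_ge0 v p q : 0 <= A -> 0 <= B -> perspective_cost A B C v ->
  0 <= p -> 0 <= q -> 0 <= v p q.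
Proof.
by move=> A0 B0 cv p0 q0; apply: le_trans (pcost_ge cv p0 q0); rewrite addr_ge0 ?mulr_ge0.
Qed.

(** Rescaling the weights turns a convex combination into a sum. *)
Lemma pcost_concave v : perspective_cost A B C v ->
  concave01 (fun p => v p (1 - p)).
Proof.
move=> cv t p q /andP[t0 t1] /andP[p0 p1] /andP[q0 q1].
rewrite -!(pcostZ cv) ?subr_ge0//.
have -> : 1 - (t * p + (1 - t) * q) = t * (1 - p) + (1 - t) * (1 - q) by ring.
by apply: (pcostD cv); rewrite mulr_ge0 ?subr_ge0.
Qed.

End perspective_cost_theory.

Lemma pcost_weaken (R : realType) (A B C A' B' : R) v : A' <= A -> B' <= B ->
  perspective_cost A B C v -> perspective_cost A' B' C v.
Proof.
move=> AA BB [mv gev lev vZ vD]; split=> // p q p0 q0.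
by apply: le_trans (gev _ _ p0 q0); rewrite lerD// ler_wpM2l.
Qed.

Section continuation.
Context d (S : measurableType d) (R : realType).
Variables (kappa : bool -> probability S R) (F : bool -> S -> R)
  (nu : {finite_measure set S -> \bar R}).
Hypotheses (mF : forall h, measurable_fun setT (F h))
  (F0 : forall h x, (0 <= F h x)%R)
  (FE : forall h A, measurable A ->
     (kappa h A = \int[nu]_(x in A) (F h x)%:E)%E).

(** The expected cost [v] after the next signal.  The absolute values only make
    the integrand nonnegative for all real weights, so that measurability in
    the weights follows from Fubini's theorem. *)
Definition continuation (v : S -> R -> R -> R) (p q : R) : R :=
  fine (\int[nu]_x (v x (`|p| * F false x) (`|q| * F true x))%:E)%E.

Variables (A B C : R) (v : S -> R -> R -> R).
Hypotheses (A0 : 0 <= A) (B0 : 0 <= B)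
  (mv : measurable_fun setT (fun x : S * (R * R) => v x.1 x.2.1 x.2.2))
  (cv : forall x, perspective_cost A B C (v x)).

Let integrand (p q : R) x := v x (`|p| * F false x) (`|q| * F true x).

Let mI p q : measurable_fun setT (integrand p q).
Proof.
apply: (measurableT_comp mv (g := fun x => (x, (`|p| * F false x, `|q| * F true x)))).
apply: measurable_fun_pair => //; apply: measurable_fun_pair => //;
  exact: measurable_funM.
Qed.

Let I0 p q x : 0 <= integrand p q x.
Proof. by apply: (pcost_ge0 A0 B0 (cv x)); rewrite mulr_ge0. Qed.

Let integral_linear a b : 0 <= a -> 0 <= b ->
  (\int[nu]_x (a * F false x + b * F true x)%:E = (a + b)%:E)%E.
Proof.
move=> a0 b0; have int1 c h : 0 <= c -> (\int[nu]_x (c * F h x)%:E = c%:E)%E.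
  move=> c0; under eq_integral do rewrite EFinM.
  rewrite ge0_integralZl//.
  - by rewrite -FE// probability_setT mule1.
  - exact/measurable_EFinP.
  - by move=> x _; rewrite lee_fin.
under eq_integral do rewrite EFinD.
rewrite ge0_integralD//.
- by rewrite !int1.
- by move=> x _; rewrite lee_fin mulr_ge0.
- by apply/measurable_EFinP; exact: measurable_funM.
- by move=> x _; rewrite lee_fin mulr_ge0.
- by apply/measurable_EFinP; exact: measurable_funM.
Qed.

Let mlin a b : measurable_fun setT (fun x => (a * F false x + b * F true x)%:E).
Proof.
by apply/measurable_EFinP; apply: measurable_funD; exact: measurable_funM.
Qed.

Let mEI p q : measurable_fun setT (EFin \o integrand p q).
Proof. exact/measurable_EFinP. Qed.

Let C0 (x : S) : 0 <= C.
Proof.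
have := le_trans (pcost_ge (cv x) ler01 ler01) (pcost_le (cv x) ler01 ler01).
rewrite !mul1r mulrDr mulr1 -mulr2n => le2.
by rewrite -(pmulrn_lge0 _ (ltn0Sn 1)); apply: le_trans le2; exact: addr_ge0.
Qed.

Let integral_le p q : (\int[nu]_x (integrand p q x)%:E <= (C * (`|p| + `|q|))%:E)%E.
Proof.
have c0 := C0 point.
rewrite mulrDr -integral_linear ?mulr_ge0//; apply: ge0_le_integral => //.
- by move=> x _; rewrite lee_fin.
- exact: mEI.
- move=> x _; rewrite lee_fin.
  by have := pcost_le (cv x) (mulr_ge0 (normr_ge0 p) (F0 false x))
    (mulr_ge0 (normr_ge0 q) (F0 true x)); rewrite mulrDr !mulrA.
Qed.

Let integral_fin p q : (\int[nu]_x (integrand p q x)%:E)%E \is a fin_num.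
Proof.
rewrite ge0_fin_numE ?(le_lt_trans (integral_le p q)) ?ltry//.
by apply: integral_ge0 => x _; rewrite lee_fin.
Qed.

Let contE p q : ((continuation v p q)%:E = \int[nu]_x (integrand p q x)%:E)%E.
Proof. by rewrite /continuation fineK//; exact: integral_fin. Qed.

Lemma continuationE (p q : R) : 0 <= p -> 0 <= q ->
  (continuation v p q)%:E = (\int[nu]_x (v x (p * F false x) (q * F true x))%:E)%E.
Proof.
move=> p0 q0; by rewrite contE /integrand !ger0_norm.
Qed.

(** Every clause passes through the integral.  The bounds keep their constants
    because the densities integrate to 1. *)
Lemma pcost_continuation : perspective_cost A B C (continuation v).
Proof.
split.
- apply: (measurableT_comp (f := fine)) => //.
  have := @measurable_fun_fubini_tonelli_F _ _ (R * R)%type S R nu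
    (fun z => (integrand z.1.1 z.1.2 z.2)%:E).
  apply.
  + apply/measurable_EFinP.
    apply: (measurableT_comp mv (g := fun z : (R * R) * S =>
      (z.2, (`|z.1.1| * F false z.2, `|z.1.2| * F true z.2)))).
    apply: measurable_fun_pair => //; apply: measurable_fun_pair => //;
      apply: measurable_funM; do ?[exact: measurableT_comp].
    * apply: measurableT_comp => //; exact: measurableT_comp.
    * apply: measurableT_comp => //; exact: measurableT_comp.
  + by move=> z; rewrite lee_fin.
- move=> p q p0 q0; rewrite -lee_fin contE -integral_linear ?mulr_ge0//.
  apply: ge0_le_integral => //.
  + by move=> x _; rewrite lee_fin addr_ge0 ?mulr_ge0.
  + exact: mEI.
  + move=> x _; rewrite lee_fin /integrand !ger0_norm// mulrAC [q * B * _]mulrAC.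
    by apply: (pcost_ge (cv x)); rewrite mulr_ge0.
- move=> p q p0 q0; rewrite -lee_fin contE.
  by have := integral_le p q; rewrite !ger0_norm.
- move=> c p q c0 p0 q0; apply: EFin_inj; rewrite EFinM !contE.
  rewrite -ge0_integralZl ?lee_fin//;
    [|exact: mEI|by move=> x _; rewrite lee_fin].
  apply: eq_integral => x _; rewrite -EFinM; congr EFin.
  rewrite /integrand !normrM [`|c|]ger0_norm// -!mulrA.
  by apply: (pcostZ (cv x)); rewrite ?mulr_ge0.
- move=> p q p' q' p0 q0 p0' q0'; rewrite -lee_fin EFinD !contE.
  rewrite -ge0_integralD//; [|by move=> x _; rewrite lee_fin|exact: mEI
    |by move=> x _; rewrite lee_fin|exact: mEI].
  apply: ge0_le_integral => //.
  + by move=> x _; rewrite adde_ge0 ?lee_fin.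
  + by apply: emeasurable_funD; exact: mEI.
  + exact: mEI.
  + move=> x _; rewrite -EFinD lee_fin /integrand !ger0_norm ?addr_ge0// !mulrDl.
    by apply: (pcostD (cv x)); rewrite mulr_ge0.
Qed.

End continuation.

(** * Countable partitions, restrictions and prefixes *)

Section countable_cases.
Context d (T : measurableType d) (C : countType) (Z : T -> C).
Hypothesis mZ : forall c, measurable (Z @^-1` [set c]).

(* The fibers of [Z], indexed by the codes of its values. *)
Let fiber (n : nat) : set T :=
  if @pickle_inv C n is Some c then Z @^-1` [set c] else set0.

Let mfiber n : measurable (fiber n).
Proof. by rewrite /fiber; case: pickle_inv. Qed.

Let fiber_cover : \bigcup_n fiber n = setT.
Proof.
apply/seteqP; split => // w _; exists (pickle (Z w)) => //.
by rewrite /fiber pickleK_inv.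
Qed.

Let fiber_triv : trivIset setT fiber.
Proof.
apply/trivIsetP => i j _ _ ij; apply/seteqP; split => // w [].
rewrite /fiber; case Ei : (pickle_inv i) => [c|//] /= Zc.
case Ej : (pickle_inv j) => [c'|//] /= Zc'.
move: ij; rewrite -(@pickle_invK C i) -(@pickle_invK C j) Ei Ej /=.
by rewrite -Zc -Zc' eqxx.
Qed.

Lemma measurable_countable_cases d' (U : measurableType d') (f : C -> T -> U) :
  (forall c, measurable_fun setT (f c)) ->
  measurable_fun setT (fun w => f (Z w) w).
Proof.
move=> mf _ B mB; rewrite setTI.
have -> : (fun w => f (Z w) w) @^-1` B =
    \bigcup_n (if @pickle_inv C n is Some c
               then Z @^-1` [set c] `&` f c @^-1` B else set0).
  apply/seteqP; split => [w /= Bw|w [n _]].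
    by exists (pickle (Z w)) => //; rewrite pickleK_inv.
  by case: pickle_inv => // c [/= ->].
apply: bigcupT_measurable => n; case: pickle_inv => // c.
by apply: measurableI => //; rewrite -[X in measurable X]setTI; exact: mf.
Qed.

Lemma le_integral_countable_cases (R : realType)
    (mu : {measure set T -> \bar R}) (D : set T) (f g : T -> \bar R) :
  measurable D -> measurable_fun setT f -> measurable_fun setT g ->
  (forall x, 0 <= f x)%E -> (forall x, 0 <= g x)%E ->
  (forall c, (\int[mu]_(x in D `&` Z @^-1` [set c]) f x <=
              \int[mu]_(x in D `&` Z @^-1` [set c]) g x)%E) ->
  (\int[mu]_(x in D) f x <= \int[mu]_(x in D) g x)%E.
Proof.
move=> mD mf mg f0 g0 fg.
have -> : D = \bigcup_n (D `&` fiber n).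
  by rewrite -setI_bigcupr fiber_cover setIT.
have mDf n : measurable (D `&` fiber n) by exact: measurableI.
have tDf : trivIset setT (fun n => D `&` fiber n) by exact: trivIset_setIl.
rewrite !ge0_integral_bigcup//; try exact: measurable_funTS.
apply: lee_nneseries => [n _ _|n _]; first by apply: integral_ge0.
rewrite /fiber; case: pickle_inv => [c|]; first exact: fg.
by rewrite setI0 !integral_set0.
Qed.

End countable_cases.

Lemma countType_measurable_fun d (T : measurableType d) d' (C : measurableType d')
    (C' : countType) (e : C' -> C) (Z : T -> C') :
  (forall c, measurable (Z @^-1` [set c])) -> measurable_fun setT (e \o Z).
Proof.
by move=> mZ; apply: (measurable_countable_cases mZ (f := fun c _ => e c)).
Qed.

Lemma ge0_integral_mrestr d (T : measurableType d) (R : realType)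
    (mu : {finite_measure set T -> \bar R}) (D : set T) (mD : measurable D)
    (A : set T) (f : T -> \bar R) :
  measurable A -> measurable_fun setT f -> (forall x, 0 <= f x)%E ->
  (\int[mrestr mu mD]_(x in A) f x = \int[mu]_(x in A `&` D) f x)%E.
Proof.
move=> mA mf f0; rewrite integral_mkcond.
rewrite (@ge0_integral_density _ _ _ mu (mrestr mu mD) (\1_D)).
- rewrite [RHS]integral_mkcond; apply: eq_integral => x _.
  by rewrite !patchE in_setI indicE; case: (x \in A); case: (x \in D);
    rewrite ?mule1 ?mule0.
- by [].
- by move=> x; rewrite indicE.
- by move=> B mB; rewrite integral_indic// /mrestr setIC.
- by apply/(measurable_restrictT _ _).1 => //; exact: measurable_funTS.
- by move=> x; rewrite patchE; case: ifP.
Qed.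

Section tuples.
Context d (T : measurableType d).

Definition tuple_init n (y : n.+1.-tuple T) : n.-tuple T :=
  [tuple tnth y (widen_ord (leqnSn n) i) | i < n].

Lemma prefix_init (y : nat -> T) n : tuple_init (prefix y n.+1) = prefix y n.
Proof. by apply: eq_from_tnth => i; rewrite !tnth_mktuple. Qed.

Lemma prefix_last (y : nat -> T) n : tnth (prefix y n.+1) ord_max = y n.+1.
Proof. by rewrite tnth_mktuple. Qed.

Lemma prefixS (y : nat -> T) n :
  prefix y n.+1 = [tuple of rcons (prefix y n) (y n.+1)].
Proof.
apply: eq_from_tnth => i; rewrite tnth_mktuple (tnth_nth (y 0%N)) /=.
rewrite nth_rcons size_map size_enum_ord.
have := ltn_ord i; rewrite ltnS leq_eqVlt => /orP[/eqP ->|lt].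
  by rewrite ltnn eqxx.
by rewrite lt -[RHS](tnth_nth _ (prefix y n) (Ordinal lt)) tnth_mktuple.
Qed.

Lemma measurable_tuple_init n : measurable_fun setT (@tuple_init n).
Proof.
apply/measurable_fun_tnthP => i.
rewrite (_ : _ \o _ = (@tnth n.+1 T ^~ (widen_ord (leqnSn n) i))).
  exact: measurable_tnth.
by apply/funext => y /=; rewrite tnth_mktuple.
Qed.

Lemma measurable_rcons n :
  measurable_fun setT (fun x : n.-tuple T * T => [tuple of rcons x.1 x.2]).
Proof.
apply/measurable_fun_tnthP => i /=.
have [lt|ge] := ltnP i n.
  rewrite (_ : _ \o _ = (@tnth n T ^~ (Ordinal lt)) \o fst).
    by apply: measurableT_comp => //; exact: measurable_tnth.
  apply/funext => -[y x] /=; rewrite !(tnth_nth x) /= nth_rcons size_tuple lt.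
  by [].
rewrite (_ : _ \o _ = snd)//.
apply/funext => -[y x] /=; rewrite !(tnth_nth x) /= nth_rcons size_tuple.
by rewrite ltnNge ge /=; case: ifP.
Qed.

Lemma measurable_prefix d' (Om : measurableType d') (Y : nat -> Om -> T) n :
  (forall t, measurable_fun setT (Y t)) ->
  measurable_fun setT (fun w => prefix (Y ^~ w) n).
Proof.
move=> mY; apply/measurable_fun_tnthP => i /=.
rewrite (_ : _ \o _ = Y i.+1)//.
by apply/funext => w /=; rewrite tnth_mktuple.
Qed.

End tuples.

(** * Dynamic programming for the second observer *)

Section dynamic_programming.
Context d d2 (Om : measurableType d) (O2 : measurableType d2) (R : realType).
Variables (P : probability Om R) (H : Om -> bool) (Y : nat -> Om -> O2)
  (Z : nat -> Om -> messages).
Hypotheses (mH : measurable_fun setT H) (mY : forall t, measurable_fun setT (Y t))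
  (mZ : forall t c, measurable (Z t @^-1` [set c]))
  (Z_take : forall k w, Z k w = take k (Z k.+1 w)).

(* The information of O2 at time [k] is the pair [info k] of its own
   observations and of the messages.  It is determined by the information at
   time [k] and the new [signal]. *)
Let past k w := prefix (Y ^~ w) k.
Let signal k w : O2 * messages := (Y k.+1 w, Z k.+1 w).
Let info k w : k.-tuple O2 * messages := (past k w, Z k w).

Hypothesis signal_indep : forall k z h A B, measurable A -> measurable B ->
  (P (H @^-1` [set h] `&` Z k @^-1` [set z] `&`
      (past k @^-1` A `&` signal k @^-1` B)) *
   P (H @^-1` [set h] `&` Z k @^-1` [set z]) =
   P (H @^-1` [set h] `&` Z k @^-1` [set z] `&` past k @^-1` A) *
   P (H @^-1` [set h] `&` Z k @^-1` [set z] `&` signal k @^-1` B))%E.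

Let measZ k : measurable_fun setT (Z k).
Proof. exact: (@countType_measurable_fun _ Om _ messages (seq (option bool)) id (Z k)). Qed.

Let mpast k : measurable_fun setT (past k).
Proof. exact: measurable_prefix. Qed.

Let msignal k : measurable_fun setT (signal k).
Proof. by apply: measurable_fun_pair => //; exact: measZ. Qed.

Let minfo k : measurable_fun setT (info k).
Proof. by apply: measurable_fun_pair; [exact: mpast|exact: measZ]. Qed.

Let mH1 h : measurable (H @^-1` [set h]).
Proof. exact: preimage_bool_measurable. Qed.

Let mHZ h k z : measurable (H @^-1` [set h] `&` Z k @^-1` [set z]).
Proof. exact: measurableI. Qed.

(** The law of the next signal given H = [h] and messages [z].  When that
    condition has probability 0, normalisation yields the Dirac mass, so that
    all densities below integrate to 1 without exception. *)
Definition signal_law k z h : probability (O2 * messages)%type R :=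
  mnormalize (image_measure (mrestr P (mHZ h k z)) (msignal k)) (dirac point).

Definition signal_density k z : bool -> O2 * messages -> R :=
  sval (cid (common_density (signal_law k z))).

Definition signal_ref k z : {finite_measure set (O2 * messages)%type -> \bar R} :=
  measure_sum (signal_law k z false) (signal_law k z true).

Let densP k z := svalP (cid (common_density (signal_law k z))).

Let mdens k z h : measurable_fun setT (signal_density k z h).
Proof. by have [/(_ h)] := densP k z. Qed.

Let dens0 k z h x : 0 <= signal_density k z h x.
Proof. by have [_ /(_ h x)] := densP k z. Qed.

Let densE k z h A : measurable A ->
  (signal_law k z h A = \int[signal_ref k z]_(x in A) (signal_density k z h x)%:E)%E.
Proof. by have [_ _ /(_ h A)] := densP k z. Qed.

Let mZ1 k z : measurable (Z k @^-1` [set z]) := mZ k z.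

(* [signal_indep] divided by the mass of the condition.  When this mass is 0,
   both sides vanish. *)
Let signal_lawP k z h A B : measurable A -> measurable B ->
  (mrestr P (mZ1 k z) (H @^-1` [set h] `&` (past k @^-1` A `&` signal k @^-1` B)) =
   mrestr P (mZ1 k z) (H @^-1` [set h] `&` past k @^-1` A) * signal_law k z h B)%E.
Proof.
move=> mA mB; have mpA : measurable (past k @^-1` A).
  by rewrite -[X in measurable X]setTI; exact: mpast.
have msB : measurable (signal k @^-1` B).
  by rewrite -[X in measurable X]setTI; exact: msignal.
have indep := signal_indep z h mA mB.
rewrite /mrestr setIAC (setIAC _ (past k @^-1` A)).
set M := P (H @^-1` [set h] `&` Z k @^-1` [set z]) in indep *.
have Mfin : M \is a fin_num by apply: fin_num_measure; exact: mHZ.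
have M0 C : measurable C -> M = 0%E ->
    P (H @^-1` [set h] `&` Z k @^-1` [set z] `&` C) = 0%E.
  move=> mC ME; apply/eqP; rewrite eq_le measure_ge0 andbT.
  rewrite -[leRHS]ME; apply: le_measure; rewrite ?inE//; exact: measurableI.
have [ME|Mneq] := eqVneq M 0%E.
  by rewrite !M0 ?mul0e//; exact: measurableI.
have lawE : (M * signal_law k z h B =
    P (H @^-1` [set h] `&` Z k @^-1` [set z] `&` signal k @^-1` B))%E.
  have -> : M = mrestr P (mHZ h k z) setT by rewrite /mrestr setTI.
  rewrite [X in _ = P X]setIC.
  exact: (mul_mnormalize (image_measure (mrestr P (mHZ h k z)) (msignal k))).
move: indep; rewrite -lawE muleCA [LHS]muleC.
move/(congr1 (fun x => (fine M)^-1%:E * x)%E).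
have MK x : ((fine M)^-1%:E * (M * x) = x)%E.
  by rewrite muleA -[X in (_ * X * _)%E](fineK Mfin) -EFinM mulVf ?mul1e ?fine_eq0.
by rewrite !MK.
Qed.

Variables (c L : R) (J : bool -> bool -> R).
Hypotheses (c0 : 0 <= c) (J0L : forall u h, 0 <= J u h <= L)
  (J1 : J true true < J false true) (J0 : J false false < J true false).

Definition stop_cost (u : bool) (k : nat) (p q : R) : R :=
  p * (c * k%:R + J u false) + q * (c * k%:R + J u true).

Definition wait_cost (k : nat) (v : messages -> R -> R -> R) (z : messages) :
    R -> R -> R :=
  continuation (signal_density k z) (signal_ref k z) (fun x => v x.2).

(** The least expected cost of O2, counted from time 1, over policies that have
    not stopped before time [k], with [n] decision times after [k], messages [z]
    and weights [p], [q] of the hypotheses.  O1's delay is left out: it does not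
    depend on O2. *)
Fixpoint value (n k : nat) (z : messages) (p q : R) : R :=
  let stop := Num.min (stop_cost false k p q) (stop_cost true k p q) in
  if n is n'.+1 then Num.min stop (wait_cost k (value n' k.+1) z p q) else stop.

(* [A k], [B k]: the cost of a correct announcement at time [k] under H = 0 and
   under H = 1. *)
Let A k := c * k%:R + J false false.
Let B k := c * k%:R + J true true.
Let C k := c * k%:R + L.

Let AS k : A k <= A k.+1.
Proof. by rewrite lerD2r ler_wpM2l// ler_nat. Qed.

Let BS k : B k <= B k.+1.
Proof. by rewrite lerD2r ler_wpM2l// ler_nat. Qed.

Let A0 k : 0 <= A k.
Proof. by rewrite addr_ge0 ?mulr_ge0//; case/andP: (J0L false false). Qed.

Let B0 k : 0 <= B k.
Proof. by rewrite addr_ge0 ?mulr_ge0//; case/andP: (J0L true true). Qed.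

Lemma pcost_stop u k : perspective_cost (A k) (B k) (C k) (stop_cost u k).
Proof.
have JL u' h : J u' h <= L by case/andP: (J0L u' h).
have [JA JB] : J false false <= J u false /\ J true true <= J u true.
  by case: u; rewrite ?lexx ?(ltW J1) ?(ltW J0).
by apply: pcost_linear; rewrite /A /B /C !lerD2l ?JA ?JB ?JL.
Qed.

(** Messages are countable, so joint measurability is measurability for each
    message list. *)
Lemma measurable_message_indexed (v : messages -> R -> R -> R) :
  (forall z, measurable_fun setT (fun x : R * R => v z x.1 x.2)) ->
  measurable_fun setT
    (fun x : (O2 * messages) * (R * R) => v x.1.2 x.2.1 x.2.2).
Proof.
move=> mv; pose Zx (x : (O2 * messages) * (R * R)) : seq (option bool) := x.1.2.
apply: (@measurable_countable_cases _ _ _ Zx _ _ _ (fun z x => v z x.2.1 x.2.2)).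
  move=> z; rewrite -[X in measurable X]setTI.
  have : measurable_fun setT (fun x : (O2 * messages) * (R * R) => x.1.2).
    exact: measurableT_comp.
  exact.
by move=> z; apply: (measurableT_comp (mv z) (g := snd)).
Qed.

Lemma pcost_wait k z v a b e : 0 <= a -> 0 <= b ->
  (forall z, perspective_cost a b e (v z)) ->
  perspective_cost a b e (wait_cost k v z).
Proof.
move=> a0 b0 cv; apply: (@pcost_continuation _ _ _ (signal_law k z)) => //.
- by move=> h D mD; exact: densE.
- by apply: measurable_message_indexed => y; exact: pcost_measurable (cv y).
Qed.

Lemma pcost_value n k z : perspective_cost (A k) (B k) (C k) (value n k z).
Proof.
elim: n k z => [|n IH] k z; first exact: pcost_min (pcost_stop false k) (pcost_stop true k).
apply: pcost_min (pcost_min (pcost_stop false k) (pcost_stop true k)) _.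
by apply: pcost_weaken (AS k) (BS k) _; apply: pcost_wait.
Qed.

Let value0 n k z (p q : R) : 0 <= p -> 0 <= q -> 0 <= value n k z p q.
Proof. exact: pcost_ge0 (A0 k) (B0 k) (pcost_value n k z). Qed.

Let mvalue n k : measurable_fun setT
  (fun x : (O2 * messages) * (R * R) => value n k x.1.2 x.2.1 x.2.2).
Proof.
by apply: measurable_message_indexed => z; exact: pcost_measurable (pcost_value n k z).
Qed.

Let pcost_wait_value n k z :
  perspective_cost (A k.+1) (B k.+1) (C k.+1) (wait_cost k (value n k.+1) z).
Proof. by apply: pcost_wait => // y; exact: pcost_value. Qed.

Let wait_costE n k z (p q : R) : 0 <= p -> 0 <= q ->
  ((wait_cost k (value n k.+1) z p q)%:E =
   \int[signal_ref k z]_x (value n k.+1 x.2 (p * signal_density k z false x)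
                                            (q * signal_density k z true x))%:E)%E.
Proof.
move=> p0 q0; rewrite /wait_cost.
apply: (@continuationE _ _ _ (signal_law k z) _ _ _ _ _ (A k.+1) (B k.+1) (C k.+1)) => //.
- by move=> h D mD; exact: densE.
- by move=> x; exact: pcost_value.
Qed.

Definition action_cost (n k : nat) (z : messages) (p q : R) (a : action) : R :=
  match a, n with
  | Some u, _ => stop_cost u k p q
  | None, n'.+1 => wait_cost k (value n' k.+1) z p q
  | None, 0%N => stop_cost false k p q
  end.

(** The value function is the minimum of the costs of the three actions. *)
Lemma value_le_action_cost n k z p q a : value n k z p q <= action_cost n k z p q a.
Proof.
case: n a => [|n] [[]|] /=; rewrite !ge_min ?lexx ?orbT //.
Qed.

Definition threshold_action (alpha beta p : R) : action :=
  if p <= alpha then Some true else if p < beta then None else Some false.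

Definition final_action (alpha p : R) : action := Some (p <= alpha).

(** At the horizon only the two announcements remain, so the threshold is the
    indifference point.  It is below 1, which is what makes it insensitive to
    clipping the belief. *)
Lemma final_threshold k : exists alpha, 0 <= alpha < 1 /\
  forall z p, action_cost 0 k z p (1 - p) (final_action alpha p)
              = value 0 k z p (1 - p).
Proof.
have [||a [/andP[a0 a1] sle sge]] := @indifference_belief _
  (fun u => c * k%:R + J u false) (fun u => c * k%:R + J u true).
- by rewrite ltrD2l.
- by rewrite ltrD2l.
exists a; split => [|z p]; first by rewrite a1 ltW.
rewrite /final_action /= /stop_cost; case: leP => pa.
  by rewrite min_r// sle.
by rewrite min_l// sge// ltW.
Qed.

(** [concave_stopping_thresholds] applied to the cost of waiting.  At beliefs 0
    and 1, waiting costs at least a correct announcement one step later. *)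
Lemma stopping_thresholds n k z : exists alpha beta,
  [/\ 0 <= alpha, alpha <= beta, beta <= 1, alpha < 1 &
   forall p, 0 <= p <= 1 ->
     action_cost n.+1 k z p (1 - p) (threshold_action alpha beta p)
     = value n.+1 k z p (1 - p)].
Proof.
have pw := pcost_wait_value n k z.
have [|||||a [b [a0 ab b1 a1 thr]]] := @concave_stopping_thresholds _
  (fun u => c * k%:R + J u false) (fun u => c * k%:R + J u true) _ _
  (fun p => wait_cost k (value n k.+1) z p (1 - p)).
- by rewrite ltrD2l.
- by rewrite ltrD2l.
- exact: pcost_concave pw.
- have := pcost_ge pw (lexx 0) ler01; rewrite subr0 mul0r add0r mul1r.
  exact: le_trans (BS k).
- have := pcost_ge pw ler01 (lexx 0); rewrite subrr mul0r addr0 mul1r.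
  exact: le_trans (AS k).
exists a, b; split => // p p01; have := thr p p01; rewrite /threshold_action.
case: ifP => _; [|case: ifP => _]; rewrite /= le_min => /andP[le1 le2].
- by rewrite (min_r le1) (min_l le2).
- by rewrite min_r// le_min le1.
- by rewrite (min_l le1) (min_l le2).
Qed.

Variables (T : nat) (pi : forall t, t.-tuple O2 * messages -> R).
Hypotheses (mpi : forall t, (t <= T)%N -> measurable_fun setT (@pi t))
  (pi01 : forall t x, 0 <= @pi t x <= 1)
  (piP : forall t, (t <= T)%N -> forall D, measurable D ->
    (\int[P]_(w in info t @^-1` D) (pi (info t w))%:E =
     P (H @^-1` [set false] `&` info t @^-1` D))%E).

Let bel h k w : R := weight h (pi (info k w)).

Let bel0 h k w : 0 <= bel h k w.
Proof. exact: weight_ge0. Qed.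

Let mbel h k : (k <= T)%N -> measurable_fun setT (bel h k).
Proof.
move=> kT; apply: (measurable_weight h (f := fun w => pi (info k w))).
exact: (measurableT_comp (mpi kT) (@minfo k)).
Qed.

(* [pi] read at fixed messages [z] is the belief for the restriction of [P] to
   the event that [z] was received. *)
Let past_posterior k z D : (k <= T)%N -> measurable D ->
  (\int[mrestr P (mZ1 k z)]_(w in past k @^-1` D) (pi (past k w, z))%:E =
   mrestr P (mZ1 k z) (H @^-1` [set false] `&` past k @^-1` D))%E.
Proof.
move=> kT mD; rewrite ge0_integral_mrestr; first last.
- by move=> w; rewrite lee_fin; case/andP: (pi01 (past k w, z)).
- apply/measurable_EFinP; apply: (measurableT_comp (mpi kT)).
  by apply: measurable_fun_pair => //; exact: mpast.
- by apply: measurable_preimage => //; exact: mpast.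
have setE : past k @^-1` D `&` Z k @^-1` [set z] = info k @^-1` (D `*` [set z]).
  by apply/seteqP; split.
rewrite /mrestr -setIA setE -piP//; last exact: measurableX.
by apply: eq_integral => w; rewrite inE => -[_ <-].
Qed.

(* The information at time [k.+1] is recovered from (past, signal) by [rcons],
   and conversely by [parts]; the event that [z] was received at time [k] is
   visible at time [k.+1] because message lists extend one another. *)
Let next_posterior k z D : (k < T)%N -> measurable D ->
  (\int[mrestr P (mZ1 k z)]_(w in (fun w => (past k w, signal k w)) @^-1` D)
     (pi ([tuple of rcons (past k w) (signal k w).1], (signal k w).2))%:E =
   mrestr P (mZ1 k z) (H @^-1` [set false] `&`
                       (fun w => (past k w, signal k w)) @^-1` D))%E.
Proof.
move=> kT mD.
have infoE w : ([tuple of rcons (past k w) (signal k w).1], (signal k w).2) = info k.+1 w.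
  by rewrite /info /past prefixS.
under eq_integral do rewrite infoE.
rewrite ge0_integral_mrestr; first last.
- by move=> w; rewrite lee_fin; case/andP: (pi01 (info k.+1 w)).
- by apply/measurable_EFinP; apply: (measurableT_comp (mpi kT)); exact: minfo.
- by apply: measurable_preimage => //; apply: measurable_fun_pair; [exact: mpast|exact: msignal].
pose parts (x : k.+1.-tuple O2 * messages) : k.-tuple O2 * (O2 * messages) :=
  (tuple_init x.1, (tnth x.1 ord_max, x.2)).
have mparts : measurable_fun setT parts.
  apply: measurable_fun_pair.
    by apply: measurableT_comp => //; exact: measurable_tuple_init.
  apply: measurable_fun_pair => //.
  by apply: (measurableT_comp (measurable_tnth ord_max)).
have mtake : measurable_fun setT
    (fun x : k.+1.-tuple O2 * messages => take k x.2 : messages).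
  by apply: (@measurableT_comp _ _ _ _ _ _ (fun z : messages => take k z : messages)).
have setE : (fun w => (past k w, signal k w)) @^-1` D `&` Z k @^-1` [set z] =
    info k.+1 @^-1` (parts @^-1` D `&` (fun x => take k x.2) @^-1` [set z]).
  apply/seteqP; split => w /=;
    by rewrite /parts /= prefix_init prefix_last -Z_take.
rewrite /mrestr -setIA setE -piP//; apply: measurableI.
  by rewrite -[X in measurable X]setTI; exact: mparts.
by rewrite -[X in measurable X]setTI; exact: mtake.
Qed.

Let mvalue_at n k k' (p q : Om -> R) :
  measurable_fun setT p -> measurable_fun setT q ->
  measurable_fun setT (fun w => (value n k (Z k' w) (p w) (q w))%:E).
Proof.
move=> mp mq; apply/measurable_EFinP.
apply: (@measurable_countable_cases _ _ (seq (option bool)) (Z k') (mZ k') _ _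
  (fun z w => value n k z (p w) (q w))) => z.
apply: (measurableT_comp (pcost_measurable (pcost_value n k z))
  (g := fun w => (p w, q w))).
exact: measurable_fun_pair.
Qed.

Let mwait_at n k z (p q : Om -> R) :
  measurable_fun setT p -> measurable_fun setT q ->
  measurable_fun setT (fun w => wait_cost k (value n k.+1) z (p w) (q w)).
Proof.
move=> mp mq; apply: (measurableT_comp (pcost_measurable (pcost_wait_value n k z))
  (g := fun w => (p w, q w))).
exact: measurable_fun_pair.
Qed.

Let wait_ge0 n k z (p q : R) : 0 <= p -> 0 <= q ->
  0 <= wait_cost k (value n k.+1) z p q.
Proof. exact: pcost_ge0 (A0 k.+1) (B0 k.+1) (pcost_wait_value n k z). Qed.

(** The dynamic programming equation, in integrated form.  Split according to
    the messages received; for each of them it is [bayes_homogeneous] under [P]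
    restricted to the corresponding event. *)
Lemma value_step n k D : (k < T)%N -> measurable D ->
  (\int[P]_(w in info k @^-1` D)
     (wait_cost k (value n k.+1) (Z k w) (bel false k w) (bel true k w))%:E =
   \int[P]_(w in info k @^-1` D)
     (value n k.+1 (Z k.+1 w) (bel false k.+1 w) (bel true k.+1 w))%:E)%E.
Proof.
move=> kT mD.
have mf : measurable_fun setT (fun w =>
    (wait_cost k (value n k.+1) (Z k w) (bel false k w) (bel true k w))%:E).
  apply/measurable_EFinP.
  apply: (@measurable_countable_cases _ _ (seq (option bool)) (Z k) (mZ k) _ _
    (fun z w => wait_cost k (value n k.+1) z (bel false k w) (bel true k w))) => z.
  by apply: mwait_at; apply: mbel; exact: ltnW.
have mg : measurable_fun setT (fun w =>
    (value n k.+1 (Z k.+1 w) (bel false k.+1 w) (bel true k.+1 w))%:E).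
  by apply: mvalue_at; exact: mbel.
have f0 w : (0 <= (wait_cost k (value n k.+1) (Z k w) (bel false k w)
    (bel true k w))%:E)%E by rewrite lee_fin wait_ge0.
have g0 w : (0 <= (value n k.+1 (Z k.+1 w) (bel false k.+1 w)
    (bel true k.+1 w))%:E)%E by rewrite lee_fin value0.
suff fib (z : seq (option bool)) :
    (\int[P]_(w in info k @^-1` D `&` Z k @^-1` [set z])
      (wait_cost k (value n k.+1) (Z k w) (bel false k w) (bel true k w))%:E =
    \int[P]_(w in info k @^-1` D `&` Z k @^-1` [set z])
      (value n k.+1 (Z k.+1 w) (bel false k.+1 w) (bel true k.+1 w))%:E)%E.
  apply/eqP; rewrite eq_le; apply/andP; split;
    apply: (@le_integral_countable_cases _ _ (seq (option bool)) (Z k) (mZ k)) => //;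
    try (by apply: measurable_preimage => //; exact: minfo); by move=> z; rewrite fib.
pose Dz := ysection D (z : messages).
have mDz : measurable Dz by exact: measurable_ysection.
have setE : info k @^-1` D `&` Z k @^-1` [set z] =
    past k @^-1` Dz `&` Z k @^-1` [set z].
  apply/seteqP; split => w /= [Dw Zw]; split=> //; move: Dw;
    by rewrite /Dz /ysection /= inE /info Zw.
have mpD : measurable (past k @^-1` Dz) by apply: measurable_preimage => //; exact: mpast.
have infoE w : ([tuple of rcons (past k w) (signal k w).1], (signal k w).2) =
    info k.+1 w by rewrite /info /past prefixS.
have mpiz : measurable_fun setT (fun y : k.-tuple O2 => pi (y, z : messages)).
  apply: (measurableT_comp (mpi (ltnW kT)) (g := fun y => (y, z : messages))).
  exact: measurable_fun_pair.
rewrite setE.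
transitivity (\int[mrestr P (mZ1 k z)]_(w in past k @^-1` Dz)
    (wait_cost k (value n k.+1) z (weight false (pi (past k w, z : messages)))
      (weight true (pi (past k w, z : messages))))%:E)%E.
  rewrite ge0_integral_mrestr//; first last.
  - by move=> w; rewrite lee_fin wait_ge0// weight_ge0.
  - apply/measurable_EFinP; apply: mwait_at;
      exact: (measurable_weight _ (measurableT_comp mpiz (@mpast k))).
  by apply: eq_integral => w; rewrite inE => -[_ <-].
transitivity (\int[mrestr P (mZ1 k z)]_(w in past k @^-1` Dz)
    (value n k.+1 (Z k.+1 w) (bel false k.+1 w) (bel true k.+1 w))%:E)%E; last first.
  by rewrite ge0_integral_mrestr.
under eq_integral do rewrite wait_costE ?weight_ge0//.
under [RHS]eq_integral do rewrite /bel -infoE.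
apply/esym.
apply: (@bayes_homogeneous _ _ _ Om _ _ R (mrestr P (mZ1 k z)) H (past k) (signal k)
   mH (@mpast k) (@msignal k) (signal_law k z) (signal_ref k z) (signal_density k z)
   _ _ _ _ (fun y => pi (y, z : messages))
   (fun x => pi ([tuple of rcons x.1 x.2.1], x.2.2))
   (fun x => value n k.+1 x.2)) => //.
- by move=> h E mE; exact: densE.
- by move=> h E F mE mF; exact: signal_lawP.
- by move=> E mE; exact: (past_posterior z (ltnW kT) mE).
- apply: (measurableT_comp (mpi kT) (g := fun x : k.-tuple O2 * (O2 * messages) =>
    ([tuple of rcons x.1 x.2.1] : k.+1.-tuple O2, x.2.2))).
  apply: measurable_fun_pair.
    apply: (measurableT_comp (@measurable_rcons _ O2 k)
      (g := fun x : k.-tuple O2 * (O2 * messages) => (x.1, x.2.1))).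
    by apply: measurable_fun_pair => //; exact: measurableT_comp.
  exact: measurableT_comp.
- by move=> E mE; exact: (next_posterior z kT mE).
- by move=> x p q p0 q0; exact: value0.
- by move=> x e p q e0 p0 q0; apply: (pcostZ (pcost_value n k.+1 x.2)).
Qed.

(** O2's realized cost if it has not stopped before time [k].  Policies
    that still wait at the horizon are made to announce 0 there, so that the
    lower bound holds without any assumption of admissibility. *)
Fixpoint run_cost (g : policy2 O2) (n k : nat) (w : Om) : R :=
  match g k (info k w), n with
  | Some u, _ => c * k%:R + J u (H w)
  | None, n'.+1 => run_cost g n' k.+1 w
  | None, 0%N => c * k%:R + J false (H w)
  end.

Let act0 n k z (p q : R) a : 0 <= p -> 0 <= q -> 0 <= action_cost n k z p q a.
Proof.
move=> p0 q0.
exact: le_trans (value0 n k z p0 q0) (value_le_action_cost _ _ _ _ _ _).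
Qed.

Let Jc0 u h k : 0 <= c * k%:R + J u h.
Proof. by rewrite addr_ge0 ?mulr_ge0//; case/andP: (J0L u h). Qed.

Lemma run_cost_ge0 g n k w : 0 <= run_cost g n k w.
Proof.
by elim: n k => [|n IH] k /=; case: (g k _) => [u|]; rewrite ?Jc0.
Qed.

Let mcostH u k : measurable_fun setT (fun w => c * k%:R + J u (H w)).
Proof.
apply: measurable_funD => //; apply: (measurableT_comp (f := J u)) => //.
Qed.

Let maction g k : measurable_fun setT (g k : _ -> action) ->
  forall a : option bool,
    measurable ((fun w => g k (info k w) : option bool) @^-1` [set a]).
Proof.
move=> mg a; rewrite -[X in measurable X]setTI.
by apply: (measurableT_comp mg (@minfo k)).
Qed.

Lemma measurable_run_cost (g : policy2 O2) n k :
  (forall t, (k <= t <= k + n)%N -> measurable_fun setT (g t)) ->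
  measurable_fun setT (run_cost g n k).
Proof.
elim: n k => [|n IH] k mg; (have mgk : measurable_fun setT (g k) by
    apply: mg; rewrite leqnn leq_addr); rewrite /=.
  apply: (@measurable_countable_cases _ _ (option bool) _ (maction mgk) _ _
    (fun a w => match a with Some u => c * k%:R + J u (H w)
                | None => c * k%:R + J false (H w) end)).
  by case=> [u|]; exact: mcostH.
apply: (@measurable_countable_cases _ _ (option bool) _ (maction mgk) _ _
  (fun a w => match a with Some u => c * k%:R + J u (H w)
              | None => run_cost g n k.+1 w end)).
case=> [u|]; first exact: mcostH.
by apply: IH => t /andP[kt tk]; apply: mg; rewrite (ltnW kt) addnS -addSn.
Qed.

Let mstop u k : (k <= T)%N ->
  measurable_fun setT (fun w => stop_cost u k (bel false k w) (bel true k w)).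
Proof.
move=> kT; apply: (measurableT_comp (pcost_measurable (pcost_stop u k))
  (g := fun w => (bel false k w, bel true k w))).
by apply: measurable_fun_pair; exact: mbel.
Qed.

Let stop0 u k w : 0 <= stop_cost u k (bel false k w) (bel true k w).
Proof. by rewrite /stop_cost addr_ge0 ?mulr_ge0. Qed.

(** On an event of O2's information, the belief may replace the indicator of the
    hypothesis. *)
Lemma integral_stop u k D : (k <= T)%N -> measurable D ->
  (\int[P]_(w in info k @^-1` D) (stop_cost u k (bel false k w) (bel true k w))%:E =
   \int[P]_(w in info k @^-1` D) (c * k%:R + J u (H w))%:E)%E.
Proof.
move=> kT mD; have miD : measurable (info k @^-1` D).
  by apply: measurable_preimage => //; exact: minfo.
have mEbel h : measurable_fun (info k @^-1` D) (fun w => (bel h k w)%:E).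
  by apply/measurable_funTS/measurable_EFinP; exact: mbel.
under eq_integral do rewrite /stop_cost [bel false k _ * _]mulrC
  [bel true k _ * _]mulrC EFinD !EFinM.
rewrite ge0_integralD//; first last.
- by apply: measurable_funeM; exact: mEbel.
- by move=> w _; rewrite -EFinM lee_fin mulr_ge0.
- by apply: measurable_funeM; exact: mEbel.
- by move=> w _; rewrite -EFinM lee_fin mulr_ge0.
rewrite !ge0_integralZl ?lee_fin//; first last.
- by move=> w _; rewrite lee_fin.
- by move=> w _; rewrite lee_fin.
have post h := @posterior_weight _ _ R P H mH _ _ _ _ (@minfo k) (mpi kT)
  (@pi01 k) (piP kT) h _ mD.
rewrite !post.
have setE : info k @^-1` D = (H @^-1` [set false] `&` info k @^-1` D) `|`
    (H @^-1` [set true] `&` info k @^-1` D).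
  rewrite -setIUl; apply/seteqP; split => [w Dw|w []//].
  by split => //=; case: (H w); [right|left].
have mHD h : measurable (H @^-1` [set h] `&` info k @^-1` D) by exact: measurableI.
rewrite [in RHS]setE ge0_integral_setU//; first last.
- by apply/disj_set2P/seteqP; split => // w /= [[-> _] []].
- by move=> w _; rewrite lee_fin.
- exact/measurable_funTS/measurable_EFinP.
have int h : (\int[P]_(w in H @^-1` [set h] `&` info k @^-1` D)
     (c * k%:R + J u (H w))%:E =
   (c * k%:R + J u h)%:E * P (H @^-1` [set h] `&` info k @^-1` D))%E.
  rewrite -integral_cst//; apply: eq_integral => w; rewrite inE => -[/= -> //].
by rewrite !int.
Qed.

(** Each action of [g] attains the minimum that defines the value function. *)
Definition greedy (g : policy2 O2) (n k : nat) : Prop :=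
  forall m t, (m + t = n + k)%N -> (k <= t)%N ->
    forall x, action_cost m t x.2 (weight false (@pi t x)) (weight true (@pi t x)) (g t x)
            = value m t x.2 (weight false (pi x)) (weight true (pi x)).

Let parent k (x : k.+1.-tuple O2 * messages) : k.-tuple O2 * messages :=
  (tuple_init x.1, take k x.2).

Let mparent k : measurable_fun setT (@parent k).
Proof.
apply: measurable_fun_pair.
  by apply: measurableT_comp => //; exact: measurable_tuple_init.
by apply: (@measurableT_comp _ _ _ _ _ _ (fun z : messages => take k z : messages)).
Qed.

Let parent_info k w : parent (info k.+1 w) = info k w.
Proof. by rewrite /parent /info /= prefix_init -Z_take. Qed.

Let actw n k (a : action) w : R :=
  action_cost n k (Z k w) (bel false k w) (bel true k w) a.

Let mactw n k a : (k + n <= T)%N -> measurable_fun setT (actw n k a).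
Proof.
move=> knT; have kT : (k <= T)%N by rewrite (leq_trans _ knT)// leq_addr.
case: n a knT => [|n] [u|] knT; try exact: mstop.
apply: (@measurable_countable_cases _ _ (seq (option bool)) (Z k) (mZ k) _ _
    (fun z w => wait_cost k (value n k.+1) z (bel false k w) (bel true k w))) => z.
by apply: mwait_at; apply: mbel.
Qed.

Let value_bounds (g : policy2 O2) n k (D : set (k.-tuple O2 * messages)) : Prop :=
  let V := (\int[P]_(w in info k @^-1` D)
              (value n k (Z k w) (bel false k w) (bel true k w))%:E)%E in
  let G := (\int[P]_(w in info k @^-1` D) (run_cost g n k w)%:E)%E in
  (V <= G)%E /\ (greedy g n k -> G <= V)%E.

(* Split the event according to the action of [g]: announcements are covered by
   [integral_stop], so only waiting is left to an assumption. *)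
Let value_bounds_step (g : policy2 O2) n k : (k + n <= T)%N ->
  (forall t, (k <= t <= k + n)%N -> measurable_fun setT (g t)) ->
  (forall D : set (k.-tuple O2 * messages), measurable D ->
    D `<=` g k @^-1` [set None] ->
    let V := (\int[P]_(w in info k @^-1` D) (actw n k None w)%:E)%E in
    let G := (\int[P]_(w in info k @^-1` D) (run_cost g n k w)%:E)%E in
    (V <= G)%E /\ (greedy g n k -> G <= V)%E) ->
  forall D : set (k.-tuple O2 * messages), measurable D -> value_bounds g n D.
Proof.
move=> knT mg wait_bounds D mD.
have kT : (k <= T)%N by rewrite (leq_trans _ knT)// leq_addr.
have mgk : measurable_fun setT (g k) by apply: mg; rewrite leqnn leq_addr.
have miD : measurable (info k @^-1` D).
  by apply: measurable_preimage => //; exact: minfo.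
pose f w := (actw n k (g k (info k w)) w)%:E.
have mf : measurable_fun setT f.
  apply/measurable_EFinP.
  by apply: (@measurable_countable_cases _ _ (option bool) _ (maction mgk) _ _
    (actw n k)) => a; exact: mactw.
have f0 w : (0 <= f w)%E by rewrite lee_fin act0.
have mr : measurable_fun setT (fun w => (run_cost g n k w)%:E).
  by apply/measurable_EFinP; exact: measurable_run_cost.
have r0 w : (0 <= (run_cost g n k w)%:E)%E by rewrite lee_fin run_cost_ge0.
have mv : measurable_fun setT
    (fun w => (value n k (Z k w) (bel false k w) (bel true k w))%:E).
  by apply: mvalue_at; exact: mbel.
have v0 w : (0 <= (value n k (Z k w) (bel false k w) (bel true k w))%:E)%E.
  by rewrite lee_fin value0.
have fib (a : option bool) :
    let Da := info k @^-1` D `&` (fun w => g k (info k w)) @^-1` [set a] in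
    (\int[P]_(w in Da) f w <= \int[P]_(w in Da) (run_cost g n k w)%:E)%E /\
    (greedy g n k ->
      \int[P]_(w in Da) (run_cost g n k w)%:E <= \int[P]_(w in Da) f w)%E.
  move=> Da; pose D' := D `&` g k @^-1` [set (a : action)].
  have DaE : Da = info k @^-1` D' by [].
  have mD' : measurable D'.
    by apply: measurableI => //; rewrite -[X in measurable X]setTI; exact: mgk.
  have fE : (\int[P]_(w in Da) f w = \int[P]_(w in Da) (actw n k a w)%:E)%E.
    by apply: eq_integral => w; rewrite inE /f => -[_ /= ->].
  rewrite fE DaE; case: a @D' @Da mD' DaE fE => [u|] D' Da mD' DaE fE; last first.
    by apply: wait_bounds => // x [_].
  have -> : actw n k (Some u) = fun w => stop_cost u k (bel false k w) (bel true k w).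
    by rewrite /actw; case: (n).
  rewrite integral_stop//.
  have -> : (\int[P]_(w in info k @^-1` D') (run_cost g n k w)%:E =
      \int[P]_(w in info k @^-1` D') (c * k%:R + J u (H w))%:E)%E.
    apply: eq_integral => w; rewrite inE => -[_ /= gu].
    by case: (n) => [|m] /=; rewrite gu.
  by [].
split.
- apply: (@le_trans _ _ (\int[P]_(w in info k @^-1` D) f w)%E).
    apply: ge0_le_integral => //; try exact: measurable_funTS.
    by move=> w _; rewrite lee_fin value_le_action_cost.
  apply: (le_integral_countable_cases (maction mgk)) => // a.
  by case: (fib a).
- move=> gr; apply: (@le_trans _ _ (\int[P]_(w in info k @^-1` D) f w)%E).
    apply: (le_integral_countable_cases (maction mgk)) => // a.
    by case: (fib a) => _; apply.
  rewrite le_eqVlt; apply/orP; left; apply/eqP; apply: eq_integral => w _.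
  by rewrite /f /actw /bel (gr n k _ _ (info k w))// addnC.
Qed.

(** Verification: backward induction on events of O2's information.  The event
    that [g] waits at time [k] is an event of the information at time [k.+1],
    which is why the statement is about all events and not only the sure one. *)
Lemma run_cost_value (g : policy2 O2) n k (D : set (k.-tuple O2 * messages)) :
  (k + n <= T)%N ->
  (forall t, (k <= t <= k + n)%N -> measurable_fun setT (g t)) -> measurable D ->
  let V := (\int[P]_(w in info k @^-1` D)
              (value n k (Z k w) (bel false k w) (bel true k w))%:E)%E in
  let G := (\int[P]_(w in info k @^-1` D) (run_cost g n k w)%:E)%E in
  (V <= G)%E /\ (greedy g n k -> G <= V)%E.
Proof.
elim: n k D => [|n IH] k D knT mg mD; apply: value_bounds_step => // {mD}D mD gN.
  have kT : (k <= T)%N by rewrite (leq_trans _ knT)// leq_addr.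
  rewrite /actw /= integral_stop//.
  suff -> : (\int[P]_(w in info k @^-1` D) (run_cost g 0 k w)%:E =
      \int[P]_(w in info k @^-1` D) (c * k%:R + J false (H w))%:E)%E by [].
  by apply: eq_integral => w; rewrite inE => /= Dw; rewrite (gN _ Dw).
have kT : (k < T)%N by rewrite (leq_trans _ knT)// addnS ltnS leq_addr.
have mpD : measurable (@parent k @^-1` D).
  by rewrite -[X in measurable X]setTI; exact: mparent.
rewrite /actw /= value_step//.
have -> : info k @^-1` D = info k.+1 @^-1` (@parent k @^-1` D).
  by apply/seteqP; split => w /=; rewrite parent_info.
have -> : (\int[P]_(w in info k.+1 @^-1` (@parent k @^-1` D))
      (run_cost g n.+1 k w)%:E =
    \int[P]_(w in info k.+1 @^-1` (@parent k @^-1` D)) (run_cost g n k.+1 w)%:E)%E.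
  apply: eq_integral => w; rewrite inE => /=; rewrite parent_info => Dw.
  by rewrite (gN _ Dw).
have [|t /andP[kt tk]||VG GV] := IH k.+1 (@parent k @^-1` D).
- by rewrite addSn -addnS.
- by apply: mg; rewrite (ltnW kt) addnS -addSn.
- exact: mpD.
split => // gr; apply: GV => m t mt kt; apply: gr; last exact: ltnW.
by rewrite mt addSn addnS.
Qed.

End dynamic_programming.

(** * Measures on tuples are determined by boxes *)

(** The scalars let two measures be compared without dividing by a probability
    that may be 0. *)
Lemma scaled_measure_unique d (T : measurableType d) (R : realType)
    (G : set (set T)) (m1 m2 : {finite_measure set T -> \bar R}) (c1 c2 : R) :
  measurable = <<s G >> -> setI_closed G -> G setT -> 0 <= c1 -> 0 <= c2 ->
  (forall A, G A -> c1 * fine (m1 A) = c2 * fine (m2 A)) ->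
  forall A, measurable A -> c1 * fine (m1 A) = c2 * fine (m2 A).
Proof.
move=> mG GI GT c10 c20 eqG A mA.
have sE (m : {finite_measure set T -> \bar R}) c (c0 : 0 <= c) D :
    measurable D -> mscale (NngNum c0) m D = (c * fine (m D))%:E.
  by move=> mD; rewrite /mscale /= EFinM fineK// fin_num_measure.
have mGA D : G D -> measurable D by rewrite mG; exact: sub_sigma_algebra.
apply: EFin_inj; rewrite -!sE//.
apply: (measure_unique G (fun=> setT)) => //.
- by rewrite bigcup_const//; exists 0%N.
- move=> D GD; have mD := mGA D GD.
  by have := congr1 EFin (eqG D GD); rewrite -(sE _ _ c10)// -(sE _ _ c20).
- by move=> _; apply: (le_lt_trans _ (ltry (c1 * fine (m1 setT)))); rewrite -(sE _ _ c10).
Qed.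

Definition box T (A : nat -> set T) n : set (n.-tuple T) :=
  [set y | forall i : 'I_n, A i (tnth y i)].
Arguments box {T} A n _.

Section boxes.
Context d (T : measurableType d) (n : nat).

Definition boxes : set (set (n.-tuple T)) :=
  [set D | exists2 A : nat -> set T, (forall t, measurable (A t)) & D = box A n].

Lemma measurable_box A : (forall t, measurable (A t)) -> measurable (box A n : set (n.-tuple T)).
Proof.
move=> mA; have -> : box A n = \bigcap_(i in [set: 'I_n]) ((@tnth n T) ^~ i @^-1` A i).
  by apply/seteqP; split => y /= Ay i; [move=> _; exact: Ay|exact: Ay].
apply: fin_bigcap_measurable; first exact: finite_finset.
move=> i _; rewrite -[X in measurable X]setTI.
exact: (@measurable_tnth _ _ _ i).
Qed.

(** Generators of the sigma-algebra of tuples constrain one coordinate, hence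
    are boxes. *)
Lemma measurable_tuple_boxes : measurable = <<s boxes >>.
Proof.
apply/seteqP; split.
- apply: smallest_sub; first exact: smallest_sigma_algebra.
  rewrite /boxes; case: n => [|m]; first by rewrite big_ord0.
  rewrite -bigcup_mkord_ord; apply: bigcup_sub => i Ii D [A mA <-].
  apply: sub_sigma_algebra; exists (fun t => if t == i then A else setT).
    by move=> t; case: ifP.
  apply/seteqP; split => y; rewrite setTI => /=.
    move=> Ay j; case: eqP => // ji.
    by have -> : j = inord i by apply/val_inj; rewrite /= inordK.
  by move=> /(_ (inord i)); rewrite inordK// eqxx.
- apply: smallest_sub; first exact: sigma_algebra_measurable.
  by move=> _ [A mA ->]; exact: measurable_box.
Qed.

Lemma boxesI : setI_closed boxes.
Proof.
move=> _ _ [A mA ->] [B mB ->]; exists (fun t => A t `&` B t).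
  by move=> t; exact: measurableI.
apply/seteqP; split => y /=; first by move=> [Ay By] i; split.
by move=> AB; split => i; have [] := AB i.
Qed.

Lemma boxesT : boxes setT.
Proof. by exists (fun=> setT) => //; apply/seteqP; split. Qed.

End boxes.

(** * Independence of the observations *)

Section observation_independence.
Context d d1 d2 (Omega : measurableType d) (O1 : measurableType d1)
  (O2 : measurableType d2) (R : realType) (P : probability Omega R) (p0 : R)
  (H : {RV P >-> bool}) (Y1 : nat -> {RV P >-> O1}) (Y2 : nat -> {RV P >-> O2})
  (law1 : nat -> bool -> probability O1 R)
  (law2 : nat -> bool -> probability O2 R).
Hypothesis model : observation_model p0 H Y1 Y2 law1 law2.

Let past1 n w := prefix (Y1 ^~ w) n.
Let past2 n w := prefix (Y2 ^~ w) n.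
Let Hyp h : set Omega := H @^-1` [set h].
Let all2 (B : nat -> set O2) n : set Omega :=
  [set w | forall t, (1 <= t <= n)%N -> B t (Y2 t w)].
Let pr (S : set Omega) : R := fine (P S).
Let q2 (B : nat -> set O2) h n : R :=
  \prod_(1 <= t < n.+1) fine (law2 t h (B t)).

Let mHyp h : measurable (Hyp h).
Proof. by apply: preimage_bool_measurable; exact: measurable_funP. Qed.

Let mpast1 n : measurable_fun setT (past1 n).
Proof. by apply: measurable_prefix => t; exact: measurable_funP. Qed.

Let mpast2 n : measurable_fun setT (past2 n).
Proof. by apply: measurable_prefix => t; exact: measurable_funP. Qed.

Let all2_box B n : all2 B n = past2 n @^-1` box (fun t => B t.+1) n.
Proof.
apply/seteqP; split => w /= Bw.
  by move=> i; rewrite tnth_mktuple; apply: Bw; rewrite /= ltn_ord.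
move=> [//|t] /= tn; have := Bw (Ordinal tn).
by rewrite tnth_mktuple.
Qed.

Let mall2 B n : (forall t, measurable (B t)) -> measurable (all2 B n).
Proof.
move=> mB; rewrite all2_box; apply: measurable_preimage; first exact: mpast2.
by apply: measurable_box => t; exact: mB.
Qed.

Let q2_ge0 B h n : 0 <= q2 B h n.
Proof. by apply: prodr_ge0 => t _; rewrite fine_ge0. Qed.

(* The model, for real numbers and boxes of tuples; tuples count coordinates
   from 0 and observations from 1. *)
Let model_real n h (A : nat -> set O1) (B : nat -> set O2) :
  (forall t, measurable (A t)) -> (forall t, measurable (B t)) ->
  pr (past1 n @^-1` box (fun t => A t.+1) n `&` (Hyp h `&` all2 B n)) =
  pr (Hyp h) * (\prod_(1 <= t < n.+1) fine (law1 t h (A t))) * q2 B h n.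
Proof.
move=> mA mB; have [_ _ mod] := model.
have fprod d' (U : measurableType d') (law : nat -> bool -> probability U R) D :
    (forall t, measurable (D t)) ->
    (\prod_(1 <= t < n.+1) law t h (D t) =
     (\prod_(1 <= t < n.+1) fine (law t h (D t)))%:E)%E.
  move=> mD; rewrite -prodEFin; apply: eq_bigr => t _.
  by rewrite fineK// fin_num_measure.
have := mod n h A B mA mB; rewrite !fprod//.
rewrite -[X in (X * _ * _)%E]fineK ?fin_num_measure//; last exact: mHyp.
rewrite -!EFinM => modE; rewrite /pr /q2 -[RHS]/(fine (_%:E)) -modE.
congr (fine (P _)); apply/seteqP; split => w /=.
  move=> [A1 [Hh B2]]; split => // -[//|t] tn; split; last exact: B2.
  by have := A1 (Ordinal tn); rewrite tnth_mktuple.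
move=> [Hh AB]; split; last by split => // t tn; have [] := AB t tn.
by move=> i; rewrite tnth_mktuple; have [] := AB i.+1 (ltn_ord i).
Qed.

(* From boxes to all events of O1's observations. *)
Let indep1 n h E B : measurable E -> (forall t, measurable (B t)) ->
  pr (past1 n @^-1` E `&` (Hyp h `&` all2 B n)) =
  pr (past1 n @^-1` E `&` Hyp h) * q2 B h n.
Proof.
move=> mE mB; rewrite mulrC -[LHS]mul1r.
have mHB : measurable (Hyp h `&` all2 B n) by apply: measurableI => //; exact: mall2.
apply: (@scaled_measure_unique _ _ R (@boxes _ O1 n)
  (image_measure (mrestr P mHB) (@mpast1 n)) (image_measure (mrestr P (mHyp h)) (@mpast1 n))
  1 (q2 B h n)) => //.
- exact: measurable_tuple_boxes.
- exact: boxesI.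
- exact: boxesT.
- move=> _ [A mA ->].
  rewrite mul1r [LHS](@model_real n h (fun t => A t.-1) B)//.
  have all2T : all2 (fun=> setT) n = setT by apply/seteqP; split.
  have -> : fine (image_measure (mrestr P (mHyp h)) (@mpast1 n) (box A n)) =
    pr (past1 n @^-1` box A n `&` (Hyp h `&` all2 (fun=> setT) n)).
    by rewrite all2T setIT.
  rewrite (@model_real n h (fun t => A t.-1) (fun=> setT))// [X in _ * (_ * X)]/q2.
  rewrite [X in _ * (_ * X)]big1 ?mulr1; first exact: mulrC.
  by move=> t _; rewrite probability_setT.
Qed.

(** Given H = [h], O1's observations up to [n], O2's observations up to [k] and
    O2's observation at [k.+1] are independent; the identity is multiplied by
    the square of the probability of the hypothesis.  The model gives it on
    boxes, and it extends first in O1's observations, then in O2's. *)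
Lemma observation_indep n k h (E : set (n.-tuple O1)) (F : set (k.-tuple O2))
    (D : set O2) :
  (k < n)%N -> measurable E -> measurable F -> measurable D ->
  pr (Hyp h) * pr (Hyp h `&` past1 n @^-1` E `&` past2 k @^-1` F `&` Y2 k.+1 @^-1` D) =
  pr (Hyp h `&` past1 n @^-1` E) * pr (Hyp h `&` past2 k @^-1` F)
  * fine (law2 k.+1 h D).
Proof.
move=> kn mE mF mD.
have mHED : measurable (Hyp h `&` past1 n @^-1` E `&` Y2 k.+1 @^-1` D).
  apply: measurableI; last exact: measurable_preimage.
  apply: measurableI => //; apply: measurable_preimage => //; exact: mpast1.
rewrite mulrAC setIAC setIC [Hyp h `&` past2 k @^-1` F]setIC.
apply: (@scaled_measure_unique _ _ R (@boxes _ O2 k)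
  (image_measure (mrestr P mHED) (@mpast2 k))
  (image_measure (mrestr P (mHyp h)) (@mpast2 k))) => //.
- exact: measurable_tuple_boxes.
- exact: boxesI.
- exact: boxesT.
- by rewrite fine_ge0.
- by rewrite mulr_ge0 ?fine_ge0.
move=> _ [B mB ->].
(* the constraints on Y2: [B] up to time [k], [last] at time [k.+1], none
   later *)
pose Bt (last : set O2) t := if (t <= k)%N then B t.-1 else if t == k.+1 then last else setT.
have mBt last : measurable last -> forall t, measurable (Bt last t).
  by move=> ml t; rewrite /Bt; case: ifP => // _; case: ifP.
have Bt_all last : all2 (Bt last) n = past2 k @^-1` box B k `&` Y2 k.+1 @^-1` last.
  apply/seteqP; split => w /=.
    move=> Bw; split; last first.
      by have := Bw k.+1 kn; rewrite /Bt ltnn eqxx.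
    move=> i; rewrite tnth_mktuple; have := Bw i.+1.
    by rewrite /Bt ltn_ord /=; apply; rewrite (leq_trans (ltn_ord i))// ltnW.
  move=> [Bw lw] [//|t] /= tn; rewrite /Bt; case: ifPn => [tk|_].
    by have := Bw (Ordinal tk); rewrite tnth_mktuple.
  by case: eqP => // -[->].
have q2_last last : measurable last ->
    q2 (Bt last) h n = fine (law2 k.+1 h last) * q2 (Bt setT) h n.
  move=> ml; rewrite /q2 !(bigD1_seq k.+1) ?mem_index_iota ?iota_uniq//=.
  rewrite /Bt ltnn eqxx probability_setT mul1r; congr (_ * _).
  by apply: eq_bigr => t /negbTE ->.
have h2 : pr (Hyp h `&` past2 k @^-1` box B k) = pr (Hyp h) * q2 (Bt setT) h n.
  have := @indep1 n h setT (Bt setT) measurableT (mBt _ measurableT).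
  by rewrite Bt_all -[_ @^-1` setT]/setT !setTI -[X in _ `&` (_ `&` X)]/setT setIT.
have := @indep1 n h E (Bt D) mE (mBt _ mD); rewrite Bt_all (q2_last _ mD) => h1.
have -> : fine (image_measure (mrestr P mHED) (@mpast2 k) (box B k)) =
  pr (past1 n @^-1` E `&` (Hyp h `&` (past2 k @^-1` box B k `&` Y2 k.+1 @^-1` D))).
  congr (fine (P _)); apply/seteqP; split => w /=; tauto.
have -> : fine (image_measure (mrestr P (mHyp h)) (@mpast2 k) (box B k)) =
  pr (Hyp h `&` past2 k @^-1` box B k).
  by congr (fine (P _)); rewrite setIC.
by rewrite h1 h2 [Hyp h `&` _]setIC; ring.
Qed.

End observation_independence.

(** * Messages and the conditional independence of signals *)

Lemma received_take T (T1 : nat) (g : policy1 T) (y : nat -> T) k :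
  received T1 g y k = take k (received T1 g y k.+1).
Proof.
rewrite /received -map_take take_iota; congr (map _ (iota 1 _)).
by rewrite minnA (minn_idPl (leqnSn k)).
Qed.

Section message_history.
Context d (O1 : measurableType d) (T1 n : nat) (g : policy1 O1).
Hypotheses (T1n : (T1 <= n)%N)
  (mg : forall t, (1 <= t <= T1)%N -> measurable_fun setT (@g t)).

(* The default value is met only when [n < t]. *)
Let initial (x : n.-tuple O1) t : t.-tuple O1 := [tuple nth point x i | i < t].

(** All the actions that O1 would choose up to [T1] if it never stopped, as a
    function of a long enough tuple of its observations. *)
Definition history (x : n.-tuple O1) : messages :=
  [seq @g t (initial x t) | t <- iota 1 T1].

(** The messages received by time [k] are a prefix of this history, cut at the
    first final message. *)
Definition received_of (k : nat) (u : messages) : messages :=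
  take (minn k (find isSome u).+1) u.

Lemma received_history y k : (tau1 T1 g y <= T1)%N ->
  received T1 g y k = received_of k (history (prefix y n)).
Proof.
move=> tau.
have -> : history (prefix y n) = [seq sent g y t | t <- iota 1 T1].
  apply/eq_in_map => t; rewrite mem_iota add1n ltnS => /andP[_ tT].
  rewrite /sent; congr (@g t); apply: eq_from_tnth => i; rewrite !tnth_mktuple.
  have ilt : (i < n)%N by rewrite (leq_trans (ltn_ord i))// (leq_trans tT).
  by rewrite -(tnth_nth _ _ (Ordinal ilt)) tnth_mktuple.
rewrite /received_of find_map -map_take take_iota /received.
have tk : (minn k (tau1 T1 g y) <= T1)%N by rewrite geq_min tau orbT.
by congr (map _ (iota 1 _)); apply/esym/minn_idPl.
Qed.

Lemma measurable_initial t : measurable_fun setT (initial ^~ t).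
Proof.
apply/measurable_fun_tnthP => i /=.
have [lt|ge] := ltnP i n.
  rewrite (_ : _ \o _ = (@tnth n O1 ^~ (Ordinal lt))); first exact: measurable_tnth.
  by apply/funext => x /=; rewrite tnth_mktuple (tnth_nth point).
rewrite (_ : _ \o _ = fun=> point)//.
by apply/funext => x /=; rewrite tnth_mktuple nth_default// size_tuple.
Qed.

Lemma measurable_history (z : messages) : measurable (history @^-1` [set z]).
Proof.
rewrite /history.
have : forall t, t \in iota 1 T1 -> measurable_fun setT (fun x => @g t (initial x t)).
  move=> t; rewrite mem_iota add1n ltnS => tT.
  exact: (measurableT_comp (mg tT) (@measurable_initial t)).
elim: (iota 1 T1) z => [|t s IH] z mgt.
  have [->|z0] := eqVneq z [::].
    by rewrite (_ : _ @^-1` _ = setT)//; apply/seteqP; split.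
  rewrite (_ : _ @^-1` _ = set0)//; apply/seteqP; split => // x /= zE.
  by rewrite -zE in z0.
case: z => [|a z].
  by rewrite (_ : _ @^-1` _ = set0)//; apply/seteqP; split.
rewrite (_ : _ @^-1` _ = (fun x => @g t (initial x t)) @^-1` [set a] `&`
    (fun x => [seq @g t (initial x t) | t <- s]) @^-1` [set z]).
  apply: measurableI.
    by rewrite -[X in measurable X]setTI; apply: mgt => //; rewrite mem_head.
  by apply: IH => t' st; apply: mgt; rewrite in_cons st orbT.
by apply/seteqP; split => x /= [-> ->].
Qed.

Lemma measurable_history_set (C : set messages) : measurable (history @^-1` C).
Proof.
have mh : measurable_fun setT history.
  apply: (@countType_measurable_fun _ _ _ messages (seq (option bool)) id history).
  exact: measurable_history.
by rewrite -[X in measurable X]setTI; exact: mh.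
Qed.

End message_history.

Section signal_independence.
Context d d1 d2 (Omega : measurableType d) (O1 : measurableType d1)
  (O2 : measurableType d2) (R : realType) (P : probability Omega R) (p0 : R)
  (H : {RV P >-> bool}) (Y1 : nat -> {RV P >-> O1}) (Y2 : nat -> {RV P >-> O2})
  (law1 : nat -> bool -> probability O1 R)
  (law2 : nat -> bool -> probability O2 R).
Hypothesis model : observation_model p0 H Y1 Y2 law1 law2.
Variables (T1 : nat) (g : policy1 O1).
Hypothesis hg : admissible1 Y1 T1 g.

Let Z k w : messages := received T1 g (Y1 ^~ w) k.
Let past k w := prefix (Y2 ^~ w) k.
Let signal k w : O2 * messages := (Y2 k.+1 w, Z k.+1 w).
Let Hyp h : set Omega := H @^-1` [set h].
Let pr (S : set Omega) : R := fine (P S).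
(* Enough observations of O1 to know all its messages, and at least as many as
   [observation_indep] requires. *)
Let N k := maxn T1 k.+1.
Let hist k w := history T1 g (prefix (Y1 ^~ w) (N k)).

Let ZE k j w : Z j w = received_of j (hist k w).
Proof.
by case: hg => _ tau; rewrite /Z (@received_history _ _ _ (N k))// leq_maxl.
Qed.

Let mprefix1 n : measurable_fun setT (fun w => prefix (Y1 ^~ w) n).
Proof. by apply: measurable_prefix => t; exact: measurable_funP. Qed.

Let mpast n : measurable_fun setT (past n).
Proof. by apply: measurable_prefix => t; exact: measurable_funP. Qed.

Let mhist k C : measurable (hist k @^-1` C).
Proof.
apply: (measurable_preimage (@mprefix1 (N k)) (A := history T1 g @^-1` C)).
by apply: measurable_history_set; exact: hg.1.
Qed.

Lemma received_measurable k z : measurable (Z k @^-1` [set z]).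
Proof.
rewrite (_ : _ @^-1` _ = hist k @^-1` (received_of k @^-1` [set z])) //.
by apply/seteqP; split => w /=; rewrite (ZE k k).
Qed.

Let mHyp h : measurable (Hyp h).
Proof. by apply: preimage_bool_measurable; exact: measurable_funP. Qed.

Let msignal k : measurable_fun setT (signal k).
Proof.
apply: measurable_fun_pair => //.
apply: (@countType_measurable_fun _ _ _ messages (seq (option bool)) id (Z k.+1)).
exact: received_measurable.
Qed.

Let hist_indep k h C F D : measurable F -> measurable D ->
  pr (Hyp h) * pr (Hyp h `&` hist k @^-1` C `&` past k @^-1` F `&` Y2 k.+1 @^-1` D) =
  pr (Hyp h `&` hist k @^-1` C) * pr (Hyp h `&` past k @^-1` F)
  * fine (law2 k.+1 h D).
Proof.
move=> mF mD.
apply: (@observation_indep _ _ _ _ _ _ _ _ _ _ _ _ _ _ model (N k) k h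
  (history T1 g @^-1` C)) => //.
  by rewrite /N leq_max ltnSn orbT.
by apply: measurable_history_set; exact: hg.1.
Qed.

(** Given H and O1's messages up to [k], O2's past is independent of the next
    signal, because messages are functions of O1's observations.  On rectangles
    it follows from three instances of [observation_indep]. *)
Lemma signal_indep k z h F S : measurable F -> measurable S ->
  (P (Hyp h `&` Z k @^-1` [set z] `&` (past k @^-1` F `&` signal k @^-1` S)) *
   P (Hyp h `&` Z k @^-1` [set z]) =
   P (Hyp h `&` Z k @^-1` [set z] `&` past k @^-1` F) *
   P (Hyp h `&` Z k @^-1` [set z] `&` signal k @^-1` S))%E.
Proof.
move=> mF mS.
have mHZ : measurable (Hyp h `&` Z k @^-1` [set z]).
  by apply: measurableI => //; exact: received_measurable.
have mpF : measurable (past k @^-1` F) by apply: measurable_preimage => //; exact: mpast.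
have mHZF : measurable (Hyp h `&` Z k @^-1` [set z] `&` past k @^-1` F).
  exact: measurableI.
have msS : measurable (signal k @^-1` S) by apply: measurable_preimage => //; exact: msignal.
have prE D : measurable D -> P D = (pr D)%:E.
  by move=> mD; rewrite fineK// fin_num_measure.
rewrite !prE//; try exact: measurableI; last by apply: measurableI => //; exact: measurableI.
rewrite -!EFinM; congr EFin; rewrite mulrC.
rewrite setIA [_ `&` signal k @^-1` S]setIC.
rewrite [Hyp h `&` _ `&` signal k @^-1` S]setIC.
apply: (@scaled_measure_unique _ _ R
  [set A `*` B | A in measurable & B in measurable]
  (image_measure (mrestr P mHZF) (@msignal k))
  (image_measure (mrestr P mHZ) (@msignal k))) => //.
- exact: measurable_prod_measurableType.
- move=> _ _ [A mA [B mB <-]] [A' mA' [B' mB' <-]].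
  exists (A `&` A'); first exact: measurableI.
  by exists (B `&` B'); [exact: measurableI|rewrite setXI].
- by exists setT => //; exists setT => //; rewrite setXTT.
- by rewrite fine_ge0.
- by rewrite fine_ge0.
move=> _ [A mA [C _ <-]].
pose Cz := received_of k @^-1` [set z].
pose CC := Cz `&` received_of k.+1 @^-1` C.
have ZkE : Z k @^-1` [set z] = hist k @^-1` Cz.
  by apply/seteqP; split => w /=; rewrite (ZE k k).
have sE : Z k @^-1` [set z] `&` signal k @^-1` (A `*` C) =
    hist k @^-1` CC `&` Y2 k.+1 @^-1` A.
  rewrite ZkE; apply/seteqP; split => w /=; rewrite (ZE k k.+1) /CC /=; tauto.
have -> : fine (image_measure (mrestr P mHZF) (@msignal k) (A `*` C)) =
    pr (Hyp h `&` hist k @^-1` CC `&` past k @^-1` F `&` Y2 k.+1 @^-1` A).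
  transitivity (pr (signal k @^-1` (A `*` C) `&`
    (Hyp h `&` Z k @^-1` [set z] `&` past k @^-1` F))) => //.
  rewrite setIC setIAC -(setIA (Hyp h `&` past k @^-1` F)) sE setIA.
  by rewrite (setIAC (Hyp h) (past k @^-1` F)).
have -> : fine (image_measure (mrestr P mHZ) (@msignal k) (A `*` C)) =
    pr (Hyp h `&` hist k @^-1` CC `&` past k @^-1` setT `&` Y2 k.+1 @^-1` A).
  transitivity (pr (signal k @^-1` (A `*` C) `&` (Hyp h `&` Z k @^-1` [set z]))) => //.
  rewrite setIC -(setIA (Hyp h) (Z k @^-1` [set z])) sE -[past k @^-1` setT]/setT.
  by rewrite setIT setIA.
rewrite -/(pr _) -/(pr _) ZkE.
have i1 := @hist_indep k h CC F A mF mA.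
have i2 := @hist_indep k h CC setT A measurableT mA.
have i3 := @hist_indep k h Cz F setT mF measurableT.
have pT : past k @^-1` setT = setT by [].
have YT : Y2 k.+1 @^-1` setT = setT by [].
rewrite YT probability_setT /= mulr1 setIT in i3; rewrite pT !setIT in i2.
rewrite pT setIT.
have pr0 E : measurable E -> pr (Hyp h) = 0 -> pr (Hyp h `&` E) = 0.
  move=> mE p00; rewrite /pr; suff -> : P (Hyp h `&` E) = 0%E by [].
  apply/eqP; rewrite eq_le measure_ge0 andbT -[X in (_ <= X%:E)%E]p00 -prE//.
  by apply: le_measure; rewrite ?inE//; exact: measurableI.
have mA2 : measurable (Y2 k.+1 @^-1` A) by exact: measurable_preimage.
have [p00|pneq] := eqVneq (pr (Hyp h)) 0.
  have mh C' := mhist k C'.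
  by rewrite -!setIA !pr0 ?mulr0//; do ![apply: measurableI => //]; exact: mh.
have alg (p e x1 x2 x3 a f l : R) : p != 0 -> p * x1 = a * f * l ->
    p * x2 = a * p * l -> p * x3 = e * f -> e * x1 = x3 * x2.
  move=> p0' e1 e2 e3; apply: (mulfI p0').
  have -> : x2 = a * l by apply: (mulfI p0'); rewrite e2; ring.
  by rewrite mulrCA e1 [RHS]mulrA e3; ring.
exact: alg pneq i1 i2 i3.
Qed.

End signal_independence.

(** * Versions of the belief with values in [0, 1] *)

Lemma null_of_pos_integral_le0 d (T : measurableType d) (R : realType)
    (mu : {measure set T -> \bar R}) (D : set T) (f : T -> \bar R) :
  measurable D -> measurable_fun D f -> (forall x, D x -> 0 < f x)%E ->
  (\int[mu]_(x in D) f x <= 0)%E -> mu D = 0%E.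
Proof.
move=> mD mf f0 intf.
have : (\int[mu]_(x in D) `|f x| = 0)%E.
  rewrite (eq_integral f); last by move=> x; rewrite inE => /f0/ltW/gee0_abs.
  by apply/eqP; rewrite eq_le intf integral_ge0// => x /f0/ltW.
move/(ae_eq_integral_abs mu mD mf) => [N [mN N0 subN]].
apply/eqP; rewrite eq_le measure_ge0 andbT -N0.
apply: le_measure; rewrite ?inE// => x Dx; apply: subN => /(_ Dx) fx0.
by have := f0 x Dx; rewrite fx0 ltxx.
Qed.

Section clip.
Context (R : realType).
Implicit Types p alpha beta : R.

(** A version of the belief may leave [[0, 1]] on a null set.  Clipping repairs
    this and, the thresholds being in [[0, 1]] with [alpha < 1], changes no
    decision. *)
Definition clip p : R := Num.max 0 (Num.min p 1).

Lemma clip01 p : 0 <= clip p <= 1.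
Proof. by rewrite /clip le_max lexx /= ge_max ler01 ge_min lexx orbT. Qed.

Lemma clip_id p : 0 <= p <= 1 -> clip p = p.
Proof. by case/andP => p0 p1; rewrite /clip min_l// max_r. Qed.

Lemma clip_le p alpha : 0 <= alpha < 1 -> (clip p <= alpha) = (p <= alpha).
Proof.
by case/andP => a0 a1; rewrite /clip ge_max a0 /= ge_min [1 <= _]leNgt a1 orbF.
Qed.

Lemma clip_lt p beta : beta <= 1 -> 0 < beta -> (clip p < beta) = (p < beta).
Proof.
by move=> b1 b0; rewrite /clip gt_max b0 /= gt_min [1 < _]ltNge b1 orbF.
Qed.

Lemma threshold_action_clip alpha beta p : 0 <= alpha < 1 -> alpha <= beta ->
  beta <= 1 -> threshold_action alpha beta (clip p) = threshold_action alpha beta p.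
Proof.
move=> a01 ab b1; rewrite /threshold_action clip_le//.
(* if [beta <= 0], then [alpha] and [beta] are 0 and one never waits *)
case: (leP p alpha) => // ap; have [b0|b0] := ltP 0 beta; first by rewrite clip_lt.
have p0 : 0 < p by case/andP: a01 => a0 _; exact: le_lt_trans a0 ap.
by rewrite !ltNge (le_trans b0)//= ?(le_trans b0 (ltW p0))//; case/andP: (clip01 p).
Qed.

Lemma final_action_clip alpha p : 0 <= alpha < 1 ->
  final_action alpha (clip p) = final_action alpha p.
Proof. by move=> a01; rewrite /final_action clip_le. Qed.

Lemma measurable_clip : measurable_fun setT clip.
Proof. by apply: measurable_maxr => //; exact: measurable_minr. Qed.

End clip.

(** The events that the version is negative, or exceeds 1, are null: on them the
    integral of the version would contradict the bounds 0 <= P(E & B) <= P(B).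
    Hence clipping changes the version on a null event only. *)
Lemma is_cond_prob_clip d d' (Omega : measurableType d) (S : measurableType d')
    (R : realType) (P : probability Omega R) (E : set Omega) (X : Omega -> S)
    (p : S -> R) :
  measurable E -> measurable_fun setT X ->
  is_cond_prob P E X p -> is_cond_prob P E X (fun x => clip (p x)).
Proof.
move=> mE mX [mp pP]; split; first exact: measurableT_comp (@measurable_clip R) mp.
have mpX : measurable_fun setT (fun w => p (X w)) by exact: measurableT_comp.
have mpre B : measurable B -> measurable (X @^-1` B).
  by move=> mB; rewrite -[Y in measurable Y]setTI; exact: mX.
have m0 : measurable [set x | p x < 0].
  rewrite (_ : [set _ | _] = p @^-1` `]-oo, 0[%classic); last first.
    by apply/seteqP; split => x /=; rewrite in_itv.
  by rewrite -[Y in measurable Y]setTI; apply: mp => //; exact: measurable_itv.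
have m1 : measurable [set x | 1 < p x].
  rewrite (_ : [set _ | _] = p @^-1` `]1, +oo[%classic); last first.
    by apply/seteqP; split => x /=; rewrite in_itv /= andbT.
  by rewrite -[Y in measurable Y]setTI; apply: mp => //; exact: measurable_itv.
have null0 : P (X @^-1` [set x | p x < 0]) = 0%E.
  apply: (@null_of_pos_integral_le0 _ _ _ P _ (fun w => (- p (X w))%:E)).
  - exact: mpre.
  - by apply/measurable_funTS/measurable_EFinP; exact: measurable_funN.
  - by move=> w /= pw; rewrite lte_fin oppr_gt0.
  rewrite -[leLHS]oppeK -integral_ge0N; last first.
    by move=> w /= /ltW pw; rewrite lee_fin oppr_ge0.
  under eq_integral do rewrite -EFinN opprK.
  by rewrite pP// oppe_le0 measure_ge0.
have null1 : P (X @^-1` [set x | 1 < p x]) = 0%E.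
  have mD := mpre _ m1.
  apply: (@null_of_pos_integral_le0 _ _ _ P _ (fun w => (p (X w) - 1)%:E)) => //.
  - by apply/measurable_funTS/measurable_EFinP; exact: measurable_funB.
  - by move=> w /= pw; rewrite lte_fin subr_gt0.
  have Dfin : P (X @^-1` [set x | 1 < p x]) \is a fin_num by exact: fin_num_measure.
  rewrite -(leeD2rE _ _ Dfin) add0e -[X in (_ + X <= _)%E]mul1e -integral_cst//.
  rewrite -ge0_integralD//; first last.
  - by apply/measurable_funTS/measurable_EFinP; exact: measurable_funB.
  - by move=> w /= /ltW pw; rewrite lee_fin subr_ge0.
  under eq_integral do rewrite -EFinD subrK.
  by rewrite pP//; apply: le_measure; rewrite ?inE//; exact: measurableI.
move=> B mB; rewrite -pP//; apply: ae_eq_integral.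
- exact: mpre.
- apply/measurable_funTS/measurable_EFinP.
  exact: (measurableT_comp (@measurable_clip R) mpX).
- exact/measurable_funTS/measurable_EFinP.
exists (X @^-1` [set x | p x < 0] `|` X @^-1` [set x | 1 < p x]); split.
- by apply: measurableU; exact: mpre.
- by apply: null_set_setU => //; exact: mpre.
- move=> w /= Nw; apply: contrapT => pw01; apply: Nw => _; congr EFin.
  apply: clip_id; rewrite !leNgt; apply/andP; split; apply/negP => h; apply: pw01;
    by [left|right].
Qed.

(** * Optimality of the threshold policy *)

(** Time tau1 is read off the messages, which makes it measurable. *)
Lemma size_received T (T1 : nat) (g : policy1 T) (y : nat -> T) :
  (tau1 T1 g y <= T1)%N -> size (received T1 g y T1) = tau1 T1 g y.
Proof. by move=> tau; rewrite size_map size_iota (minn_idPr tau). Qed.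

Lemma run_cost_stop_time d d2 (Om : measurableType d) (O2 : measurableType d2)
    (R : realType) (H : Om -> bool) (Y : nat -> Om -> O2)
    (Z : nat -> Om -> messages) (c : R) (J : bool -> bool -> R)
    (g : policy2 O2) n k w :
  let u t := g t (prefix (Y ^~ w) t, Z t w) in
  let s := (k + find (fun t => isSome (u t)) (iota k n.+1))%N in
  has (fun t => isSome (u t)) (iota k n.+1) ->
  run_cost H Y Z c J g n k w = c * s%:R + J (odflt false (u s)) (H w).
Proof.
move=> u; elim: n k => [|n IH] k /=.
  by rewrite orbF -/(u k); case E : (u k) => [v|//] _; rewrite addn0 E.
rewrite -/(u k); case E : (u k) => [v|] /=; first by rewrite addn0 E.
by move=> hs; rewrite IH// addnS addSn.
Qed.

Theorem theorem4 (R : realType) (d d1 d2 : measure_display)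
  (Omega : measurableType d) (O1 : measurableType d1) (O2 : measurableType d2)
  (P : probability Omega R)
  (p0 : R) (H : {RV P >-> bool})
  (Y1 : nat -> {RV P >-> O1}) (Y2 : nat -> {RV P >-> O2})
  (lambda1 : {sigma_finite_measure set O1 -> \bar R})
  (lambda2 : {sigma_finite_measure set O2 -> \bar R})
  (law1 : nat -> bool -> probability O1 R)
  (law2 : nat -> bool -> probability O2 R)
  (hlaw1 : forall t, (1 <= t)%N -> discrete_or_density lambda1 (law1 t))
  (hlaw2 : forall t, (1 <= t)%N -> discrete_or_density lambda2 (law2 t))
  (hmodel : observation_model p0 H Y1 Y2 law1 law2)
  (T1 T2 : nat) (hT1 : (1 <= T1)%N) (hT12 : (T1 <= T2)%N)
  (c1 c2 L : R) (J : bool -> bool -> R)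
  (hc1 : 0 < c1) (hc2 : 0 < c2)
  (hJ : forall u h, 0 <= J u h <= L)
  (hJ1 : J true true < J false true)
  (hJ0 : J false false < J true false)
  (g1 : policy1 O1) (hg1 : admissible1 Y1 T1 g1) :
  exists (alphaT : R) (alpha beta : nat -> messages -> R),
    [/\ 0 <= alphaT <= 1,
        forall k z, [/\ 0 <= alpha k z, alpha k z <= beta k z & beta k z <= 1]
      & forall pi : forall t : nat, t.-tuple O2 * messages -> R,
          is_belief2 H Y1 Y2 T1 T2 g1 pi ->
          exists g2 : policy2 O2,
            [/\ optimal2 H Y1 Y2 c1 c2 J T1 T2 g1 g2,
                forall (y : T2.-tuple O2) (z : messages),
                  g2 T2 (y, z) =
                    if pi T2 (y, z) <= alphaT then Some true else Some false
              & forall k, (1 <= k < T2)%N ->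
                forall (y : k.-tuple O2) (z : messages),
                  g2 k (y, z) =
                    if pi k (y, z) <= alpha k z then Some true
                    else if pi k (y, z) < beta k z then None
                    else Some false]].
Proof.
have mH : measurable_fun setT H by exact: measurable_funP.
pose Y t : Omega -> O2 := Y2 t.
have mY t : measurable_fun setT (Y t) by exact: measurable_funP.
pose Z k w : messages := received T1 g1 (Y1 ^~ w) k.
have mZ t z : measurable (Z t @^-1` [set z]) := received_measurable hg1 t z.
have Z_take k w : Z k w = take k (Z k.+1 w) by exact: received_take.
have indep := @signal_indep _ _ _ _ _ _ _ _ _ _ _ _ _ _ hmodel T1 g1 hg1.
have [alphaT [aT01 aTP]] := final_threshold P mH mY mZ c2 hJ1 hJ0 T2.
(* for [k < T2] there are [T2 - k] decision times after [k], written so that the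
   predecessor is explicit *)
have /choice [thr thrP] : forall kz : nat * messages, exists ab : R * R,
    [/\ 0 <= ab.1, ab.1 <= ab.2, ab.2 <= 1, ab.1 < 1 &
     forall p, 0 <= p <= 1 ->
     action_cost P mH mY mZ c2 J (T2 - kz.1.+1).+1 kz.1 kz.2 p (1 - p)
       (threshold_action ab.1 ab.2 p) =
     value P mH mY mZ c2 J (T2 - kz.1.+1).+1 kz.1 kz.2 p (1 - p)].
  move=> [k z]; have [a [b]] := stopping_thresholds P mH mY mZ (ltW hc2) hJ hJ1 hJ0
    (T2 - k.+1) k z.
  by exists (a, b).
pose alpha k z := (thr (k, z)).1; pose beta k z := (thr (k, z)).2.
exists alphaT, alpha, beta; split.
- by case/andP: aT01 => -> /ltW ->.
- by move=> k z; have [] := thrP (k, z).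
move=> pi pi_belief.
pose g2 : policy2 O2 := fun t x =>
  if (t < T2)%N then threshold_action (alpha t x.2) (beta t x.2) (pi t x)
  else final_action alphaT (pi t x).
exists g2; split; first last.
- by move=> k /andP[_ kT] y z; rewrite /g2 kT.
- by move=> y z; rewrite /g2 ltnn /final_action; case: ifP.
have T2_gt0 : (0 < T2)%N := leq_trans hT1 hT12.
pose pic t x := clip (pi t x).
have minfo t : measurable_fun setT (fun w => (prefix (Y ^~ w) t, Z t w)).
  apply: measurable_fun_pair; first exact: measurable_prefix.
  apply: (@countType_measurable_fun _ _ _ messages (seq (option bool)) id (Z t)).
  exact: mZ.
have pic_belief : is_belief2 H Y1 Y2 T1 T2 g1 pic.
  move=> t tT; apply: is_cond_prob_clip; last exact: pi_belief.
    exact: preimage_bool_measurable.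
  exact: minfo.
have pic01 t x : 0 <= pic t x <= 1 by exact: clip01.
have g2_greedy : greedy P mH mY mZ c2 J pic g2 T2.-1 1.
  move=> m t; rewrite addn1 prednK// => mt _ x.
  case: m mt => [|m] mt.
    rewrite add0n in mt; subst t.
    by rewrite /g2 ltnn -(final_action_clip _ aT01); exact: aTP.
  have tT : (t < T2)%N by rewrite -mt addSn ltnS leq_addl.
  have -> : m = (T2 - t.+1)%N by rewrite -mt addSn subSS addnK.
  have [a0 ab b1 a1 opt] := thrP (t, x.2).
  rewrite /g2 tT -threshold_action_clip ?a0//.
  exact: (opt _ (pic01 t x)).
have adm2 : admissible2 Y1 Y2 T1 T2 g1 g2.
  split.
    move=> t /andP[_ tT]; have mpi : measurable_fun setT (pi t) by have [] := pi_belief t tT.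
    have mle (a : R) : measurable_fun setT (fun x => pi t x <= a).
      exact: measurable_fun_ler.
    case tT2 : (t < T2)%N; rewrite /g2 tT2; last first.
      by apply: (measurableT_comp (f := fun b : bool => Some b : action)
        (g := fun x => pi t x <= alphaT)).
    apply: (@measurable_countable_cases _ (t.-tuple O2 * messages)%type
      (seq (option bool)) (fun x => x.2) _ _ action
      (fun z x => threshold_action (alpha t z) (beta t z) (pi t x))).
      move=> z; rewrite -[X in measurable X]setTI.
      have : measurable_fun setT (@snd (t.-tuple O2) messages) by [].
      exact.
    move=> z; rewrite /threshold_action; apply: measurable_fun_ifT => //.
    by apply: measurable_fun_ifT => //; exact: measurable_fun_ltr.
  move=> w; rewrite /tau2 /stop_time -[X in (_ <= X)%N](size_iota 1 T2) -has_find.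
  apply/hasP; exists T2; first by rewrite mem_iota T2_gt0 add1n ltnSn.
  by rewrite /decision2 /g2 ltnn.
split => // g' adm'.
have mrun g : admissible2 Y1 Y2 T1 T2 g1 g ->
    measurable_fun setT (run_cost H Y Z c2 J g T2.-1 1).
  case=> mg _; apply: measurable_run_cost => // t.
  by rewrite add1n prednK//; exact: mg.
have run_ge0 g w : 0 <= run_cost H Y Z c2 J g T2.-1 1 w.
  exact: run_cost_ge0 (ltW hc2) hJ g T2.-1 1 w.
(* O1's delay contributes the same term for every policy of O2. *)
have costE g : admissible2 Y1 Y2 T1 T2 g1 g ->
    expected_cost H Y1 Y2 c1 c2 J T1 T2 g1 g =
    (\int[P]_w (c1 * (tau1 T1 g1 (Y1 ^~ w))%:R)%:E +
     \int[P]_w (run_cost H Y Z c2 J g T2.-1 1 w)%:E)%E.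
  move=> adm; rewrite /expected_cost unlock -ge0_integralD//.
  - apply: eq_integral => w _; rewrite -EFinD; congr EFin.
    rewrite /realized_cost -addrA; congr (_ + _).
    rewrite run_cost_stop_time; first by rewrite prednK.
    by rewrite prednK// has_find size_iota; exact: adm.2.
  - by move=> w _; rewrite lee_fin mulr_ge0// ltW.
  - apply/measurable_EFinP; apply: measurable_funM => //.
    have -> : (fun w => (tau1 T1 g1 (Y1 ^~ w))%:R : R) = (fun w => (size (Z T1 w))%:R).
      by apply/funext => w; rewrite size_received//; exact: hg1.2.
    exact: (@measurable_countable_cases _ _ (seq (option bool)) (Z T1) (mZ T1) _ _
      (fun z _ => (size z)%:R : R)).
  - by move=> w _; rewrite lee_fin.
  - by apply/measurable_EFinP; exact: mrun.
rewrite !costE//; apply: leeD2l.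
have mpic t : (t <= T2)%N -> measurable_fun setT (pic t).
  by move=> tT; have [] := pic_belief t tT.
have picP t : (t <= T2)%N -> forall D, measurable D -> _ :=
  fun tT => (pic_belief t tT).2.
have bounds g (adm : admissible2 Y1 Y2 T1 T2 g1 g) :=
  @run_cost_value _ _ _ _ _ P H Y Z mH mY mZ Z_take indep c2 L J (ltW hc2)
    hJ hJ1 hJ0 T2 pic mpic pic01 picP g T2.-1 1 setT.
have T2E : (1 + T2.-1)%N = T2 by rewrite add1n prednK.
have [|||_ /(_ g2_greedy) g2_le] := bounds g2 adm2; rewrite ?T2E//.
  exact: adm2.1.
apply: le_trans g2_le _.
have [|||le_g' _] := bounds g' adm'; rewrite ?T2E//.
exact: adm'.1.
Qed.
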